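(* Let $\Omega\subseteq\mathbb{H}$ be a symmetric slice domain and let $f$ be a regular function on $\Omega$. If $p\in\mathbb{H}$ is an essential singularity for $f$ and if $U$ is a symmetric neighborhood of $p$ in $\mathbb{H}$, then $f(\Omega\cap U)$ is dense in $\mathbb{H}$.
   Context: $\mathbb{H}$ denotes the quaternions, $\mathbb{S}=\{q\in\mathbb{H}:q^2=-1\}$, and $x+y\mathbb{S}=\{x+Jy:J\in\mathbb{S}\}$. For $\Omega\subseteq\mathbb{H}$ and $I\in\mathbb{S}$ put $\Omega_I=\Omega\cap(\mathbb{R}+I\mathbb{R})$ and $f_I=f|_{\Omega_I}$. A function $f:\Omega\to\mathbb{H}$ on an open set is regular if for all $I\in\mathbb{S}$, $f_I$ has continuous partial derivatives and $\frac12\left(\frac{\partial}{\partial x}+I\frac{\partial}{\partial y}\right)f_I(x+Iy)\equiv0$. A set is symmetric if together with each $x+Iy$ it contains $x+y\mathbb{S}$. A domain (connected open set) $\Omega$ is a slice domain if it meets the real axis and every $\Omega_I$ is a domain in $\mathbb{R}+I\mathbb{R}$. For $p\in\mathbb{R}+I\mathbb{R}$ and $n\in\mathbb{Z}$, $(q-p)^{*n}$ is the regular function (on $\mathbb{H}$ if $n\ge0$, on $\mathbb{H}$ minus the sphere $x+y\mathbb{S}$ through $p$ if $n<0$) whose restriction to $\mathbb{R}+I\mathbb{R}$ is $(z-p)^n$. Singularities. Put $\sigma(q,p)=\tau(q,p)=|q-p|$ if $p,q$ lie on a common complex line $\mathbb{R}+I\mathbb{R}$, and otherwise $\sigma(q,p)=\sqrt{(\mathrm{Re}\,q-\mathrm{Re}\,p)^2+(|\mathrm{Im}\,q|+|\mathrm{Im}\,p|)^2}$,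 $\tau(q,p)=\sqrt{(\mathrm{Re}\,q-\mathrm{Re}\,p)^2+(|\mathrm{Im}\,q|-|\mathrm{Im}\,p|)^2}$. Let $\Sigma(p,0,R)=\{q:\tau(q,p)>0,\ \sigma(q,p)<R\}$. If $f$ is regular on a symmetric slice domain $\Omega$, a point $p\in\mathbb{H}$ is a singularity for $f$ if $\Sigma(p,0,R)\subseteq\Omega$ for some $R>0$; then $f(q)=\sum_{n\in\mathbb{Z}}(q-p)^{*n}a_n$ in $\Sigma(p,0,R)$, whose restriction to the complex line $\mathbb{R}+I\mathbb{R}$ through $p$ is the Laurent expansion $f_I(z)=\sum_{n\in\mathbb{Z}}(z-p)^na_n$ in $0<|z-p|<R$. The singularity $p$ is a pole if there is $m\ge0$ with $a_{-k}=0$ for all $k>m$; it is an essential singularity if it is not a pole. *)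

(* Defs.v *)
From HB Require Import structures.
From mathcomp Require Import all_boot all_order all_algebra.
From mathcomp Require Import all_classical all_reals all_analysis.
From mathcomp Require Import ring lra.

Set Implicit Arguments.
Unset Strict Implicit.
Unset Printing Implicit Defensive.

Import Order.TTheory GRing.Theory Num.Theory.
Import numFieldNormedType.Exports.

Local Open Scope classical_set_scope.
Local Open Scope ring_scope.

(* Quat a b c d is a + b i + c j + d k. *)
Record quaternion (R : realType) := Quat { qre : R; qi : R; qj : R; qk : R }.

Section QuaternionAlgebra.
Variable R : realType.
Local Notation H := (quaternion R).
Implicit Types (p q r : H) (a : R).

Lemma quatP p q :
  qre p = qre q -> qi p = qi q -> qj p = qj q -> qk p = qk q -> p = q.
Proof. by case: p q => [? ? ? ?] [? ? ? ?] /= -> -> -> ->. Qed.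

Definition quat_tuple q := (qre q, qi q, qj q, qk q).
Definition tuple_quat (t : R * R * R * R) := Quat t.1.1.1 t.1.1.2 t.1.2 t.2.
Lemma quat_tupleK : cancel quat_tuple tuple_quat. Proof. by case. Qed.

HB.instance Definition _ := Choice.copy H (can_type quat_tupleK).

Definition quat_add p q :=
  Quat (qre p + qre q) (qi p + qi q) (qj p + qj q) (qk p + qk q).
Definition quat_opp p := Quat (- qre p) (- qi p) (- qj p) (- qk p).

Fact quat_addA : associative quat_add.
Proof. by move=> p q r; apply: quatP; rewrite /= addrA. Qed.
Fact quat_addC : commutative quat_add.
Proof. by move=> p q; apply: quatP; rewrite /= addrC. Qed.
Fact quat_add0 : left_id (Quat 0 0 0 0) quat_add.
Proof. by move=> p; apply: quatP; rewrite /= add0r. Qed.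
Fact quat_addN : left_inverse (Quat 0 0 0 0) quat_opp quat_add.
Proof. by move=> p; apply: quatP; rewrite /= addNr. Qed.

HB.instance Definition _ :=
  GRing.isZmodule.Build H quat_addA quat_addC quat_add0 quat_addN.

Definition quat_mul p q := Quat
  (qre p * qre q - qi p * qi q - qj p * qj q - qk p * qk q)
  (qre p * qi q + qi p * qre q + qj p * qk q - qk p * qj q)
  (qre p * qj q - qi p * qk q + qj p * qre q + qk p * qi q)
  (qre p * qk q + qi p * qj q - qj p * qi q + qk p * qre q).

Fact quat_mulA : associative quat_mul.
Proof. by move=> p q r; apply: quatP => /=; ring. Qed.
Fact quat_mul1l : left_id (Quat 1 0 0 0) quat_mul.
Proof. by move=> p; apply: quatP => /=; ring. Qed.
Fact quat_mul1r : right_id (Quat 1 0 0 0) quat_mul.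
Proof. by move=> p; apply: quatP => /=; ring. Qed.
Fact quat_mulDl : left_distributive quat_mul quat_add.
Proof. by move=> p q r; apply: quatP => /=; ring. Qed.
Fact quat_mulDr : right_distributive quat_mul quat_add.
Proof. by move=> p q r; apply: quatP => /=; ring. Qed.
Fact quat_1neq0 : Quat 1 0 0 0 != 0 :> H.
Proof. by apply/eqP => -[] /eqP; rewrite oner_eq0. Qed.

HB.instance Definition _ := GRing.Zmodule_isNzRing.Build H
  quat_mulA quat_mul1l quat_mul1r quat_mulDl quat_mulDr quat_1neq0.

Definition quat_scale a q := Quat (a * qre q) (a * qi q) (a * qj q) (a * qk q).

Fact quat_scaleA a b q :
  quat_scale a (quat_scale b q) = quat_scale (a * b) q.
Proof. by apply: quatP; rewrite /= mulrA. Qed.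
Fact quat_scale1 : left_id 1 quat_scale.
Proof. by move=> q; apply: quatP; rewrite /= mul1r. Qed.
Fact quat_scaleDr : right_distributive quat_scale +%R.
Proof. by move=> a p q; apply: quatP; rewrite /= mulrDr. Qed.
Fact quat_scaleDl q : {morph quat_scale^~ q : a b / a + b}.
Proof. by move=> a b; apply: quatP; rewrite /= mulrDl. Qed.

HB.instance Definition _ := GRing.Zmodule_isLmodule.Build R H
  quat_scaleA quat_scale1 quat_scaleDr quat_scaleDl.

Fact quat_scaleAl a p q : a *: (p * q) = (a *: p) * q.
Proof. by apply: quatP => /=; ring. Qed.
HB.instance Definition _ := GRing.Lmodule_isLalgebra.Build R H quat_scaleAl.

Fact quat_scaleAr a p q : a *: (p * q) = p * (a *: q).
Proof. by apply: quatP => /=; ring. Qed.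
HB.instance Definition _ := GRing.Lalgebra_isAlgebra.Build R H quat_scaleAr.

Definition sqnorm q := qre q ^+ 2 + qi q ^+ 2 + qj q ^+ 2 + qk q ^+ 2.

Lemma sqnorm_ge0 q : 0 <= sqnorm q.
Proof. by rewrite !addr_ge0 ?sqr_ge0. Qed.

Lemma sqnorm_eq0 q : sqnorm q = 0 -> q = 0.
Proof.
move/eqP; rewrite !paddr_eq0 ?addr_ge0 ?sqr_ge0 // !sqrf_eq0.
by move=> /andP[/andP[/andP[/eqP ? /eqP ?] /eqP ?] /eqP ?]; apply: quatP.
Qed.

Definition quat_conj q := Quat (qre q) (- qi q) (- qj q) (- qk q).

(* As required by unitRingType, the total inverse fixes the only non-unit, 0;
   here this holds because 0^-1 = 0 in R. *)
Definition quat_inv q : H := (sqnorm q)^-1 *: quat_conj q.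

Fact quat_mulVr : {in [pred q : H | q != 0], left_inverse 1 quat_inv *%R}.
Proof.
move=> q; rewrite inE => q0.
have N0 : sqnorm q != 0 by apply: contra_neq q0; exact: sqnorm_eq0.
by apply: quatP => /=; rewrite /sqnorm /= in N0 *; by field.
Qed.
Fact quat_mulrV : {in [pred q : H | q != 0], right_inverse 1 quat_inv *%R}.
Proof.
move=> q; rewrite inE => q0.
have N0 : sqnorm q != 0 by apply: contra_neq q0; exact: sqnorm_eq0.
by apply: quatP => /=; rewrite /sqnorm /= in N0 *; by field.
Qed.
Fact quat_unitP p q : q * p = 1 /\ p * q = 1 -> p != 0.
Proof.
by move=> [qp _]; apply/eqP => p0; move: qp; rewrite p0 mulr0 => /esym/eqP;
   rewrite oner_eq0.
Qed.
Fact quat_inv_out : {in [predC [pred q : H | q != 0]], quat_inv =1 id}.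
Proof.
move=> q; rewrite !inE negbK => /eqP ->.
by apply: quatP; rewrite /= ?oppr0 mulr0.
Qed.

HB.instance Definition _ := GRing.NzRing_hasMulInverse.Build H
  quat_mulVr quat_mulrV quat_unitP quat_inv_out.

Definition quat_norm q : R := Num.sqrt (sqnorm q).

Fact quat_normD p q : quat_norm (p + q) <= quat_norm p + quat_norm q.
Proof.
rewrite -(@ler_pXn2r _ 2) ?nnegrE ?addr_ge0 ?sqrtr_ge0 //.
rewrite sqrrD !sqr_sqrtr ?sqnorm_ge0 // -sqrtrM ?sqnorm_ge0 //.
pose s := qre p * qre q + qi p * qi q + qj p * qj q + qk p * qk q.
have -> : sqnorm (p + q) = sqnorm p + s *+ 2 + sqnorm q.
  by rewrite /sqnorm /s /=; ring.
rewrite lerD2r lerD2l lerMn2r /=; apply: (le_trans (ler_norm s)).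
rewrite -sqrtr_sqr ler_sqrt ?mulr_ge0 ?sqnorm_ge0 //.
(* Lagrange's identity: the difference is the square norm of Im (conj p * q) *)
rewrite -subr_ge0.
set d := (X in 0 <= X); have -> : d =
  qi (quat_conj p * q) ^+ 2 + qj (quat_conj p * q) ^+ 2
  + qk (quat_conj p * q) ^+ 2.
  by rewrite /d /s /sqnorm /=; ring.
by rewrite !addr_ge0 ?sqr_ge0.
Qed.
Fact quat_normZ a q : quat_norm (a *: q) = `|a| * quat_norm q.
Proof.
rewrite -sqrtr_sqr -sqrtrM ?sqr_ge0 //; congr Num.sqrt.
by rewrite /sqnorm /=; ring.
Qed.
Fact quat_norm0_eq0 q : quat_norm q = 0 -> q = 0.
Proof.
move/eqP; rewrite sqrtr_eq0 => q_le0.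
by apply: sqnorm_eq0; apply/eqP; rewrite eq_le q_le0 sqnorm_ge0.
Qed.

HB.instance Definition _ :=
  Lmodule_isNormed.Build R H quat_normD quat_normZ quat_norm0_eq0.

End QuaternionAlgebra.

Section RegularFunctions.
Variable R : realType.
Local Notation H := (quaternion R).
Implicit Types (A : set H) (f : H -> H) (p q I J : H) (x y r : R).

Definition imag_unit : set H := [set q | q ^+ 2 = -1].

(* The identification of R^2 with the complex line R + I R. *)
Definition slice_pt I (z : R * R) : H := z.1%:A + z.2 *: I.

Definition complex_line I : set H := range (slice_pt I).

Definition slice A I : set (R * R) := slice_pt I @^-1` A.

Definition imag_sphere x y : set H := [set slice_pt J (x, y) | J in imag_unit].

(* f is total, but for A open only its values on A matter: each slice of A is
   open in R^2, and derivatives are local. *)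
Definition regular_on A f := forall I, imag_unit I ->
  let fI := f \o slice_pt I in
  forall z, slice A I z ->
    [/\ derivable fI z (1, 0), derivable fI z (0, 1),
        {for z, continuous ('D_(1, 0) fI)},
        {for z, continuous ('D_(0, 1) fI)}
      & 2^-1 *: ('D_(1, 0) fI z + I * 'D_(0, 1) fI z) = 0].

Definition symmetric_set A := forall x y I, imag_unit I ->
  A (slice_pt I (x, y)) -> imag_sphere x y `<=` A.

Definition slice_domain A :=
  [/\ open A, connected A, exists x, A x%:A
    & forall I, imag_unit I -> open (slice A I) /\ connected (slice A I)].

Definition same_line p q :=
  exists I, [/\ imag_unit I, complex_line I p & complex_line I q].

Definition quat_Im q : H := q - (qre q)%:A.

Definition sigma_dist q p : R :=
  if `[< same_line p q >] then `|q - p|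
  else Num.sqrt ((qre q - qre p) ^+ 2 + (`|quat_Im q| + `|quat_Im p|) ^+ 2).

Definition tau_dist q p : R :=
  if `[< same_line p q >] then `|q - p|
  else Num.sqrt ((qre q - qre p) ^+ 2 + (`|quat_Im q| - `|quat_Im p|) ^+ 2).

Definition Sigma p r1 r2 : set H :=
  [set q | r1 < tau_dist q p /\ sigma_dist q p < r2].

Definition same_sphere p q :=
  exists x y, imag_sphere x y p /\ imag_sphere x y q.

Definition star_power_dom p (n : int) : set H :=
  if 0 <= n then setT else ~` [set q | same_sphere p q].

(* g is (q - p)^{*n}; this determines g on star_power_dom p n. *)
Definition is_star_power p (n : int) (g : H -> H) :=
  regular_on (star_power_dom p n) g /\
  forall I, imag_unit I -> complex_line I p ->
    forall z, complex_line I z -> star_power_dom p n z -> g z = (z - p) ^ n.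

Definition has_bilateral_sum (u : int -> H) (s : H) :=
  exists s1 s2, [/\ series (fun k : nat => u k%:Z) @ \oo --> s1,
                    series (fun k : nat => u (- k.+1%:Z)) @ \oo --> s2
                  & s = s1 + s2].

Definition is_laurent_expansion f p r (a : int -> H) :=
  exists g : int -> H -> H, (forall n, is_star_power p n (g n)) /\
    forall q, Sigma p 0 r q -> has_bilateral_sum (fun n => g n q * a n) (f q).

Definition is_singularity A p := exists2 r, 0 < r & Sigma p 0 r `<=` A.

(* The coefficients of a Laurent expansion at p do not depend on r. *)
Definition is_pole A f p :=
  exists r (a : int -> H),
    [/\ 0 < r, Sigma p 0 r `<=` A, is_laurent_expansion f p r a
      & exists m : nat, forall k : nat, (m < k)%N -> a (- k%:Z) = 0].

Definition is_essential_singularity A f p :=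
  is_singularity A p /\ ~ is_pole A f p.

End RegularFunctions.

(* Main.v *)
From HB Require Import structures.
Require Import Defs.
From mathcomp Require Import all_boot all_order all_algebra.
From mathcomp Require Import all_classical all_reals all_analysis.
From mathcomp Require Import ring lra zify.
Import numFieldNormedType.Exports.

(* Let I be an imaginary unit with p in R + I R, and suppose that f(Omega & U)
   misses the ball of center v and radius e. The identity principle gives the
   representation formula f(x + J y) = A(x, y) + J B(x, y) on Omega, for all
   imaginary units J. Subtracting v from f, we get |A + J B| >= e for all J near
   p. The complex function N = |A|^2 - |B|^2 + 2 I <A, B> is holomorphic, and
   |N| is the product of the minimum and the maximum of |A + J B| over J; hence
   |N| >= e^2 and e |f - v| <= |N|. So 1/N is holomorphic and bounded near p,
   whence |1/N| >= k |z - p|^m by its power series, and (z - p)^m f is bounded: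
   p is a pole.

   The only complex analysis needed is the power series expansion of a function
   that is continuous on a disc and holomorphic off its center. It follows from
   Cauchy's formula, obtained by contracting the circle to z through
   z + t (zeta - z); at the one value of t at which the contracted circle meets
   the center, continuity in t suffices. Everything is done with values in the
   quaternions, R + I R acting by left multiplication. *)

Set Implicit Arguments.
Unset Strict Implicit.
Unset Printing Implicit Defensive.

Import Order.TTheory GRing.Theory Num.Theory.

Local Open Scope classical_set_scope.
Local Open Scope ring_scope.

(** * Quaternion algebra and its complex lines *)

(** Inverting f - v directly fails: quaternion values do not commute with I, so 1 / (f - v) is in
    general not regular. The function N replaces f - v because its values lie in R + I R, where
    products and inverses stay holomorphic. It is the sum of the squares of the four components A_k
    + I B_k, each holomorphic by the Cauchy-Riemann equations of the pair (A, B).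

    A lower bound for |f - v| on one complex line does not bound N from below, since the minimum of
    |A + J B| runs over a whole sphere; this is where the symmetry of U enters. The two bounds on
    |N| come from min >= e together with max >= e and max >= |f - v|.

    The estimate on the line through p gives a Laurent expansion there only, while a pole asks for
    one on Sigma(p, 0, r). If p is not real, a small r keeps Sigma inside the line. If p is real,
    the representation formula, applied to f and to every star power, carries the expansion to the
    other lines. *)

Section QuaternionBasics.
Variable R : realType.
Local Notation H := (quaternion R).
Implicit Types (p q r : H) (a b t : R) (z w : R * R).

Lemma qnormE q : `|q| = Num.sqrt (sqnorm q).
Proof. by []. Qed.

Lemma qnorm_sqr q : `|q| ^+ 2 = sqnorm q.
Proof. by rewrite qnormE sqr_sqrtr ?sqnorm_ge0. Qed.

Lemma sqnormM p q : sqnorm (p * q) = sqnorm p * sqnorm q.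
Proof. by rewrite /sqnorm /=; ring. Qed.

Lemma qnormM p q : `|p * q| = `|p| * `|q|.
Proof. by rewrite !qnormE sqnormM sqrtrM ?sqnorm_ge0. Qed.

Lemma qnorm1 : `|1 : H| = 1.
Proof. by rewrite qnormE /sqnorm /= !expr0n /= expr1n !addr0 sqrtr1. Qed.

Lemma qnormX q n : `|q ^+ n| = `|q| ^+ n.
Proof. by elim: n => [|n IH]; rewrite ?expr0 ?qnorm1 // !exprS qnormM IH. Qed.

Lemma qunitE q : (q \is a GRing.unit) = (q != 0).
Proof. by []. Qed.

Lemma qmulVr q : q != 0 -> q^-1 * q = 1.
Proof. by move=> q0; rewrite mulVr. Qed.

Lemma qmulrV q : q != 0 -> q * q^-1 = 1.
Proof. by move=> q0; rewrite mulrV. Qed.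

Lemma qnormV q : `|q^-1| = `|q|^-1.
Proof.
have [->|q0] := eqVneq q 0; first by rewrite invr0 normr0 invr0.
have n0 : `|q| != 0 by rewrite normr_eq0.
by apply: (mulIf n0); rewrite mulVf // -qnormM qmulVr ?qnorm1.
Qed.

(** The Euclidean inner product of R^4. Pairing with a fixed p reduces limits, derivatives and
    integrals of quaternion functions to real ones. *)
Definition qdot p q : R := qre p * qre q + qi p * qi q + qj p * qj q + qk p * qk q.

Lemma qdotE p q : qdot p q = qre (quat_conj p * q).
Proof. by rewrite /qdot /=; ring. Qed.

Lemma qdotC p q : qdot p q = qdot q p.
Proof. by rewrite /qdot; ring. Qed.

Lemma qdotqq q : qdot q q = `|q| ^+ 2.
Proof. by rewrite qnorm_sqr /qdot /sqnorm; ring. Qed.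

Lemma qdot_is_linear p : linear (qdot p).
Proof. by move=> a q r; rewrite /qdot /= /GRing.scale /=; ring. Qed.

HB.instance Definition _ p :=
  GRing.isLinear.Build R H R _ (qdot p) (qdot_is_linear p).

Lemma qnorm_conj q : `|quat_conj q| = `|q|.
Proof. by rewrite !qnormE /sqnorm /= !sqrrN. Qed.

Lemma le_qre q : `|qre q| <= `|q|.
Proof.
rewrite qnormE -sqrtr_sqr ler_sqrt ?sqnorm_ge0 // /sqnorm -!addrA lerDl.
by rewrite !addr_ge0 ?sqr_ge0.
Qed.

Lemma le_qdot p q : `|qdot p q| <= `|p| * `|q|.
Proof. by rewrite qdotE (le_trans (le_qre _)) // qnormM qnorm_conj. Qed.

(** Left multiplication by [q] has left multiplication by its conjugate as adjoint, so a left factor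
    can be moved onto the test vector. *)
Lemma qdot_mulr p q r : qdot p (q * r) = qdot (quat_conj q * p) r.
Proof. by rewrite /qdot /=; ring. Qed.

Lemma qdot_ext p q : (forall r, qdot r p = qdot r q) -> p = q.
Proof.
move=> pq; apply/eqP; rewrite -subr_eq0 -normr_eq0 -sqrf_eq0 -qdotqq.
by rewrite linearB /= pq subrr.
Qed.

End QuaternionBasics.

(** * Limits of inner products, products and inverses *)

Section QuaternionLimits.
Variable R : realType.
Local Notation H := (quaternion R).
Implicit Types (p q r : H) (a b t : R) (z w : R * R).

Lemma qdot_cvg (T : Type) (F : set_system T) {FF : Filter F} (f : T -> H) p q :
  f @ F --> q -> (fun x => qdot p (f x)) @ F --> qdot p q.
Proof.
move=> fq; apply/subr_cvg0/norm_cvg0P.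
have fq0 : (fun x => f x - q) @ F --> 0 by apply/subr_cvg0.
have ub : (fun x => `|p| * `|f x - q|) @ F --> 0.
  rewrite (_ : 0 = `|p| * `|0 : H|); last by rewrite normr0 mulr0.
  by apply: cvgM; [exact: cvg_cst|exact: cvg_norm].
apply: (squeeze_cvgr _ (cvg_cst 0) ub); near=> x.
by rewrite normr_ge0 /= -linearB /= le_qdot.
Unshelve. all: by end_near. Qed.

Lemma qmul_cvg (T : Type) (F : set_system T) {FF : Filter F} (f g : T -> H) p q :
  f @ F --> p -> g @ F --> q -> (fun x => f x * g x) @ F --> p * q.
Proof.
move=> fp gq; apply/subr_cvg0/norm_cvg0P.
have fp0 : (fun x => f x - p) @ F --> 0 by apply/subr_cvg0.
have gq0 : (fun x => g x - q) @ F --> 0 by apply/subr_cvg0.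
have ub : (fun x => `|f x - p| * `|g x| + `|p| * `|g x - q|) @ F --> 0.
  rewrite (_ : 0 = `|0 : H| * `|q| + `|p| * `|0 : H|).
    apply: cvgD; apply: cvgM; do ?exact: cvg_norm; exact: cvg_cst.
  by rewrite normr0 mul0r mulr0 addr0.
apply: (squeeze_cvgr _ (cvg_cst 0) ub); near=> x.
rewrite normr_ge0 /= -!qnormM (le_trans _ (ler_normD _ _)) //.
by rewrite mulrBl mulrBr addrA subrK.
Unshelve. all: by end_near. Qed.

Lemma qinv_cvg (T : Type) (F : set_system T) {FF : Filter F} (f : T -> H) p :
  p != 0 -> f @ F --> p -> (fun x => (f x)^-1) @ F --> p^-1.
Proof.
move=> p0 fp; apply/subr_cvg0/norm_cvg0P.
have fp0 : (fun x => f x - p) @ F --> 0 by apply/subr_cvg0.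
have n0 : `|p| != 0 by rewrite normr_eq0.
have ub : (fun x => `|f x|^-1 * `|f x - p| * `|p|^-1) @ F --> 0.
  rewrite (_ : 0 = `|p|^-1 * `|0 : H| * `|p|^-1).
    apply: cvgM; last exact: cvg_cst.
    by apply: cvgM; [apply: cvgV => //|]; exact: cvg_norm.
  by rewrite normr0 mulr0 mul0r.
have fn0 : \forall x \near F, f x != 0.
  have /cvgr_norm_gt : f @ F --> p by [].
  move=> /(_ 0); rewrite normr_gt0 => /(_ p0); apply: filterS => x.
  by rewrite normr_gt0.
apply: (squeeze_cvgr _ (cvg_cst 0) ub); near=> x.
have fx0 : f x != 0 by near: x.
rewrite normr_ge0 /= -!qnormV -!qnormM.
suff -> : (f x)^-1 - p^-1 = - ((f x)^-1 * (f x - p) * p^-1) by rewrite normrN.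
by rewrite mulrBr mulrBl qmulVr // mul1r -mulrA qmulrV // mulr1 opprB.
Unshelve. all: by end_near. Qed.

End QuaternionLimits.

(** * The sphere of imaginary units and coordinates on complex lines *)

Section ImaginaryUnits.
Variable R : realType.
Local Notation H := (quaternion R).
Implicit Types (p q r I J : H) (a b t : R) (z w : R * R).

Lemma imag_unitE I : imag_unit I <-> qre I = 0 /\ qi I ^+ 2 + qj I ^+ 2 + qk I ^+ 2 = 1.
Proof.
rewrite /imag_unit /=; split=> [|[r0 n1]]; last first.
  by apply: quatP; rewrite /= ?r0; move: n1; rewrite !expr2 => n1; [lra|ring..].
case: I => a b c d; rewrite expr2 => -[/= h1 h2 h3 h4].
(* The imaginary components of the square are 2ab, 2ac and 2ad; with a nonzero they would leave a^2
   = -1. *)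
have a0 : a = 0.
  apply: contra_eq (h1) => a0.
  have b0 : b = 0 by apply: (mulfI a0); lra.
  have c0 : c = 0 by apply: (mulfI a0); lra.
  have d0 : d = 0 by apply: (mulfI a0); lra.
  have := sqr_ge0 a; rewrite b0 c0 d0 expr2 => a2; apply/eqP; lra.
by split=> //; move: h1; rewrite a0 !expr2; lra.
Qed.

Lemma imag_unit_sqr I : imag_unit I -> I * I = -1.
Proof. by move=> <-; rewrite expr2. Qed.

Lemma imag_unitN I : imag_unit I -> imag_unit (- I).
Proof. by rewrite /imag_unit /= sqrrN. Qed.

Lemma qnorm_imag_unit I : imag_unit I -> `|I| = 1.
Proof.
move=> /imag_unitE[I0 I1]; rewrite qnormE /sqnorm I0 expr0n add0r I1.
by rewrite sqrtr1.
Qed.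

Lemma slice_ptE I z :
  slice_pt I z = Quat (z.1 + z.2 * qre I) (z.2 * qi I) (z.2 * qj I) (z.2 * qk I).
Proof. by apply: quatP; rewrite /slice_pt /=; ring. Qed.

Lemma slice_ptD I z w : slice_pt I (z + w) = slice_pt I z + slice_pt I w.
Proof. by rewrite /slice_pt /= !scalerDl addrACA. Qed.

Lemma slice_ptZ I a z : slice_pt I (a *: z) = a *: slice_pt I z.
Proof. by rewrite /slice_pt /= scalerDr !scalerA. Qed.

Lemma slice_ptB I z w : slice_pt I (z - w) = slice_pt I z - slice_pt I w.
Proof. by rewrite -scaleN1r slice_ptD slice_ptZ scaleN1r. Qed.

Lemma slice_pt0 I : slice_pt I 0 = 0.
Proof. by rewrite /slice_pt /= !scale0r addr0. Qed.

Lemma slice_pt_real I a : slice_pt I (a, 0) = a%:A.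
Proof. by rewrite /slice_pt /= scale0r addr0. Qed.

Lemma slice_ptN I z : slice_pt (- I) z = slice_pt I (z.1, - z.2).
Proof. by rewrite /slice_pt /= scaleNr scalerN. Qed.

(** Complex multiplication in coordinates. It does not mention I, which lets computations on one
    line be transported to all the others. *)
Definition cmul z w : R * R := (z.1 * w.1 - z.2 * w.2, z.1 * w.2 + z.2 * w.1).

Lemma slice_ptM I z w : imag_unit I ->
  slice_pt I z * slice_pt I w = slice_pt I (cmul z w).
Proof.
move=> /imag_unitE[I0 I1]; rewrite !slice_ptE I0.
apply: quatP => /=; [|ring..].
by rewrite -[z.2 * w.2]mulr1 -I1; ring.
Qed.

Lemma slice_ptMC I z w : imag_unit I ->
  slice_pt I z * slice_pt I w = slice_pt I w * slice_pt I z.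
Proof.
move=> I1; rewrite !slice_ptM //; congr slice_pt.
by congr (_, _); ring.
Qed.

Lemma qnorm_slice_pt I z : imag_unit I ->
  `|slice_pt I z| = Num.sqrt (z.1 ^+ 2 + z.2 ^+ 2).
Proof.
move=> /imag_unitE[I0 I1]; rewrite slice_ptE I0 qnormE /sqnorm /=.
congr Num.sqrt; rewrite mulr0 addr0 !exprMn -!addrA -!mulrDr.
by rewrite !addrA I1 mulr1.
Qed.

Lemma slice_pt_eq0 I z : imag_unit I -> slice_pt I z = 0 -> z = 0.
Proof.
move=> I1 /eqP; rewrite -normr_eq0 qnorm_slice_pt // sqrtr_eq0 => le0.
have := sqr_ge0 z.1; have := sqr_ge0 z.2 => h2 h1.
have e1 : z.1 ^+ 2 = 0 by lra.
have e2 : z.2 ^+ 2 = 0 by lra.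
move/eqP: e1; move/eqP: e2; rewrite !sqrf_eq0 => /eqP e2 /eqP e1.
by case: z e1 e2 {le0 h1 h2} => ? ? /= -> ->.
Qed.

Lemma slice_pt_inj I : imag_unit I -> injective (slice_pt I).
Proof.
move=> I1 z w zw; apply/eqP; rewrite -subr_eq0; apply/eqP.
by apply: (slice_pt_eq0 I1); rewrite slice_ptB zw subrr.
Qed.

Lemma slice_pt_continuous I : continuous (slice_pt I).
Proof.
move=> z; rewrite /slice_pt; apply: cvgD; apply: cvgZr_tmp.
  exact: cvg_fst.
exact: cvg_snd.
Qed.

(** Normalizing to y >= 0 makes y the norm of the imaginary part; at a real q the unit is
    arbitrary. *)
Lemma on_slice q : exists I x y, [/\ imag_unit I, 0 <= y & q = slice_pt I (x, y)].
Proof.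
pose s := qi q ^+ 2 + qj q ^+ 2 + qk q ^+ 2; pose y := Num.sqrt s.
have s0 : 0 <= s by rewrite !addr_ge0 ?sqr_ge0.
have y2 : y ^+ 2 = s by rewrite sqr_sqrtr.
have [y0|y0] := eqVneq y 0.
  exists (Quat 0 1 0 0), (qre q), 0; split=> //.
    by apply/imag_unitE; split=> //=; rewrite expr1n !expr0n !addr0.
  move: y2; rewrite y0 expr0n /= => /esym/eqP; rewrite !paddr_eq0 ?addr_ge0 ?sqr_ge0 //.
  rewrite !sqrf_eq0 => /andP[/andP[/eqP i0 /eqP j0] /eqP k0].
  by rewrite slice_ptE; apply: quatP => /=; rewrite ?i0 ?j0 ?k0; ring.
exists (Quat 0 (qi q / y) (qj q / y) (qk q / y)), (qre q), y; split.
- apply/imag_unitE; split=> //=; rewrite !expr_div_n -!mulrDl y2 divff //.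
  by rewrite -/s -y2 sqrf_eq0.
- exact: sqrtr_ge0.
- by rewrite slice_ptE; apply: quatP => /=; field.
Qed.

End ImaginaryUnits.

(** * Directional derivatives and holomorphy on a complex line *)

Section DirectionalDerivatives.
Variables (R : realType) (V : normedModType R).
Local Notation H := (quaternion R).
Implicit Types (f g : V -> H) (x v : V) (p q : H).

Lemma is_deriveP (W : normedModType R) (f : V -> W) x v df :
  is_derive x v f df <->
  (fun h : R => h^-1 *: (f (h *: v + x) - f x)) @ 0^' --> df.
Proof.
split=> [[dvb <-]|dvb]; first exact: dvb.
by apply: DeriveDef; [apply/cvg_ex; exists df|apply/cvg_lim].
Qed.

(** A derivative in one direction gives continuity along that direction only, which is what the
    product and inverse rules use. *)
Lemma is_derive_cvg (W : normedModType R) (f : V -> W) x v df :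
  is_derive x v f df -> (fun h : R => f (h *: v + x)) @ 0^' --> f x.
Proof.
move=> [dvb _].
suff : {for 0, continuous (fun h : R => f(h *: v + x))}.
  by move=> /continuous_withinNx; rewrite scale0r add0r.
exact/differentiable_continuous/derivable1_diffP/(derivable1P _ _ _).1.
Qed.

Lemma is_derive_qdot f x v p df :
  is_derive x v f df -> is_derive x v (fun y => qdot p (f y)) (qdot p df).
Proof.
move=> /is_deriveP dvb; apply/is_deriveP.
rewrite (_ : (fun h => _) = fun h => qdot p (h^-1 *: (f (h *: v + x) - f x))).
  exact: qdot_cvg.
by apply/funext => h; rewrite [RHS]linearZ /= [in RHS]linearB.
Qed.

Lemma is_deriveqM f g x v df dg :
  is_derive x v f df -> is_derive x v g dg ->
  is_derive x v (fun y => f y * g y) (df * g x + f x * dg).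
Proof.
move=> /[dup] /is_derive_cvg fc /is_deriveP dvf.
move=> /[dup] /is_derive_cvg gc /is_deriveP dvg; apply/is_deriveP.
rewrite (_ : (fun h => _) = fun h =>
  (h^-1 *: (f (h *: v + x) - f x)) * g (h *: v + x) +
  f x * (h^-1 *: (g (h *: v + x) - g x))).
  by apply: cvgD; apply: qmul_cvg => //; exact: cvg_cst.
apply/funext => h; rewrite -scalerAl -scalerAr -scalerDr; congr (_ *: _).
by rewrite mulrBl mulrBr addrA subrK.
Qed.

Lemma is_deriveqMl f x v df c :
  is_derive x v f df -> is_derive x v (fun y => c * f y) (c * df).
Proof.
move=> dvf; have := is_deriveqM (is_derive_cst c x v) dvf.
by rewrite mul0r add0r.
Qed.

Lemma is_deriveqV f x v df : f x != 0 ->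
  is_derive x v f df ->
  is_derive x v (fun y => (f y)^-1) (- ((f x)^-1 * df * (f x)^-1)).
Proof.
move=> fx0 /[dup] /is_derive_cvg fc /is_deriveP dvf; apply/is_deriveP.
have fn0 : \forall h \near 0^', f (h *: v + x) != 0.
  have := @cvgr_norm_gt R H _ _ _ _ _ fc 0.
  rewrite normr_gt0 => /(_ _ fx0); apply: filterS => h.
  by rewrite normr_gt0.
apply: (@cvg_trans _ ((fun h => - ((f (h *: v + x))^-1 *
    (h^-1 *: (f (h *: v + x) - f x)) * (f x)^-1)) @ 0^')); last first.
  apply: cvgN; apply: qmul_cvg; last exact: cvg_cst.
  by apply: qmul_cvg => //; exact: qinv_cvg.
apply: near_eq_cvg; near=> h.
have fh0 : f (h *: v + x) != 0 by near: h.
have -> : (f (h *: v + x))^-1 - (f x)^-1 =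
    - ((f (h *: v + x))^-1 * (f (h *: v + x) - f x) * (f x)^-1).
  by rewrite mulrBr mulrBl qmulVr // mul1r -mulrA qmulrV // mulr1 opprB.
move: (f (h *: v + x))^-1 (f x)^-1 => a b.
by rewrite -scalerAr -scalerAl -scalerN.
Unshelve. all: by end_near. Qed.

End DirectionalDerivatives.

(** * Total differentiability from continuous partial derivatives *)

Section C1Differentiable.
Variable R : realType.
Implicit Types (z w : R * R).
Local Notation e1 := ((1, 0) : R * R).
Local Notation e2 := ((0, 1) : R * R).

Lemma near_prod_ball z (P : R * R -> Prop) : (\forall w \near z, P w) <->
  exists2 e : R, 0 < e & forall x y, `|x - z.1| < e -> `|y - z.2| < e -> P (x, y).
Proof.
split.
  move=> /nbhs_ballP[e /= e0 ze]; exists e => // x y xe ye; apply: ze.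
  by split; rewrite -ball_normE /ball_ /= distrC.
move=> [e e0 ze]; apply/nbhs_ballP; exists e => //= -[x y] [/= xe ye].
by apply: ze; rewrite distrC; [move: xe|move: ye]; rewrite -ball_normE.
Qed.

Lemma is_derive_horiz (g : R * R -> R) x y d :
  is_derive ((x, y) : R * R) e1 g d -> is_derive x 1 (fun t => g (t, y)) d.
Proof.
move=> /is_deriveP gd; apply/is_deriveP.
rewrite (_ : (fun h => _) = (fun h => h^-1 *: (g (h *: e1 + (x, y)) - g (x, y)))) //.
apply/funext => h; congr (_ *: (g _ - _)); congr (_, _) => /=.
by rewrite /GRing.scale /= mulr0 add0r.
Qed.

Lemma is_derive_vert (g : R * R -> R) x y d :
  is_derive ((x, y) : R * R) e2 g d -> is_derive y 1 (fun t => g (x, t)) d.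
Proof.
move=> /is_deriveP gd; apply/is_deriveP.
rewrite (_ : (fun h => _) = (fun h => h^-1 *: (g (h *: e2 + (x, y)) - g (x, y)))) //.
apply/funext => h; congr (_ *: (g _ - _)); congr (_, _) => /=.
by rewrite /GRing.scale /= mulr0 add0r.
Qed.

(** Stated with [min] and [max] because increments of either sign occur in [C1_increment]. *)
Lemma mean_value (g dg : R -> R) (a b : R) :
  (forall t : R, Num.min a b <= t <= Num.max a b -> is_derive t 1 g (dg t)) ->
  exists2 c, Num.min a b <= c <= Num.max a b & g b - g a = dg c * (b - a).
Proof.
wlog ab : a b / a <= b => [wl|].
  have /orP[ab|ba] := le_total a b; first exact: wl.
  rewrite minC maxC => /(wl _ _ ba)[c cab gab]; exists c => //.
  by rewrite -opprB gab -mulrN opprB.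
rewrite (min_idPl ab) (max_idPr ab) => dvg.
have [t tab||c cab gab] := @MVT_segment R g dg a b ab.
- by apply: dvg; rewrite !ltW ?(itvP tab).
- apply: derivable_within_continuous => t tab.
  by apply: ex_derive; apply: dvg; rewrite !(itvP tab).
- by exists c; rewrite ?(itvP cab).
Qed.

(** Going from (x0, y0) to (x, y) through the corner (x, y0), the mean value theorem applies on each
    leg, and each partial derivative has moved by less than e / 2. *)
Lemma C1_increment (g g1 g2 : R * R -> R) z :
  (\forall w \near z, is_derive w e1 g (g1 w)) ->
  (\forall w \near z, is_derive w e2 g (g2 w)) ->
  {for z, continuous g1} -> {for z, continuous g2} ->
  forall e, 0 < e -> \forall w \near z,
    `|g w - g z - (g1 z * (w.1 - z.1) + g2 z * (w.2 - z.2))| <=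
      e * Num.max `|w.1 - z.1| `|w.2 - z.2|.
Proof.
move=> dv1 dv2 c1 c2 e e0.
have e20 : 0 < e / 2 by rewrite divr_gt0.
have n1 : \forall w \near z, `|g1 z - g1 w| < e / 2.
  exact: (@cvgr_dist_lt R R _ (nbhs z) _ g1 (g1 z) c1 _ e20).
have n2 : \forall w \near z, `|g2 z - g2 w| < e / 2.
  exact: (@cvgr_dist_lt R R _ (nbhs z) _ g2 (g2 z) c2 _ e20).
have /near_prod_ball[d d0 zd] : \forall w \near z,
  [/\ is_derive w e1 g (g1 w), is_derive w e2 g (g2 w),
    `|g1 z - g1 w| < e / 2 & `|g2 z - g2 w| < e / 2].
  by near=> w; split; near: w.
apply/near_prod_ball; exists d => // x y xd yd.
case: z {dv1 dv2 c1 c2 n1 n2} zd xd yd => x0 y0 /= zd xd yd.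
have btw (a b t : R) : Num.min a b <= t <= Num.max a b -> `|b - a| < d -> `|t - a| < d.
  rewrite ge_min le_max => /andP[/orP t1 /orP t2] dab.
  by case: t1 => ?; case: t2 => ?;
    move: dab; rewrite !ltr_norml => /andP[? ?]; apply/andP; split; lra.
have ddy (a : R) : `|a - a| < d by rewrite subrr normr0.
have [c cx gx] : exists2 c, `|c - x0| < d &
    g (x, y0) - g (x0, y0) = g1 (c, y0) * (x - x0).
  have [t tx|c cx gx] := @mean_value (fun t => g (t, y0)) (fun t => g1 (t, y0)) x0 x.
    by apply: is_derive_horiz; have [] := zd t y0 (btw _ _ _ tx xd) (ddy _).
  by exists c => //; exact: btw cx xd.
have [c' cy gy] : exists2 c, `|c - y0| < d &
    g (x, y) - g (x, y0) = g2 (x, c) * (y - y0).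
  have [t ty|c' cy gy] := @mean_value (fun t => g (x, t)) (fun t => g2 (x, t)) y0 y.
    by apply: is_derive_vert; have [] := zd x t xd (btw _ _ _ ty yd).
  by exists c' => //; exact: btw cy yd.
have [_ _ b1 _] := zd c y0 cx (ddy _).
have [_ _ _ b2] := zd x c' xd cy.
have -> : g (x, y) - g (x0, y0) - (g1 (x0, y0) * (x - x0) + g2 (x0, y0) * (y - y0))
    = - ((g1 (x0, y0) - g1 (c, y0)) * (x - x0)) -
      (g2 (x0, y0) - g2 (x, c')) * (y - y0).
  rewrite -[g (x, y)](subrK (g (x, y0))) gy -[g (x, y0)](subrK (g (x0, y0))) gx.
  by ring.
rewrite (le_trans (ler_normB _ _)) // normrN !normrM.
set m := Num.max _ _; rewrite [e]splitr mulrDl.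
by apply: lerD; apply: ler_pM => //; do ?exact: ltW; rewrite /m le_max lexx ?orbT.
Unshelve. all: by end_near. Qed.

End C1Differentiable.

Section Chain.
Variable R : realType.
Local Notation e1 := ((1, 0) : R * R).
Local Notation e2 := ((0, 1) : R * R).

Lemma is_derive_chain (g g1 g2 : R * R -> R) (x y : R -> R) (t dx dy : R) :
  (\forall w \near (x t, y t), is_derive w e1 g (g1 w)) ->
  (\forall w \near (x t, y t), is_derive w e2 g (g2 w)) ->
  {for (x t, y t), continuous g1} -> {for (x t, y t), continuous g2} ->
  is_derive t 1 x dx -> is_derive t 1 y dy ->
  is_derive t 1 (fun s => g (x s, y s)) (g1 (x t, y t) * dx + g2 (x t, y t) * dy).
Proof.
move=> dv1 dv2 c1 c2 /[dup] /is_derive_cvg cx /is_deriveP dvx.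
move=> /[dup] /is_derive_cvg cy /is_deriveP dvy; apply/is_deriveP.
have cxy : (fun h : R => (x (h *: 1 + t), y (h *: 1 + t))) @ 0^' --> (x t, y t).
  exact: (cvg_pair cx cy).
pose qx h := h^-1 *: (x (h *: 1 + t) - x t).
pose qy h := h^-1 *: (y (h *: 1 + t) - y t).
have main : (fun h => g1 (x t, y t) * qx h + g2 (x t, y t) * qy h) @ 0^' -->
    g1 (x t, y t) * dx + g2 (x t, y t) * dy.
  by apply: cvgD; apply: cvgM => //; exact: cvg_cst.
apply/(@cvgrPdist_le _ _ _ (0^')) => e e0.
(* A common bound for both difference quotients near [t]; dividing by it turns the error of
   [C1_increment] into at most e / 2. *)
have M0 : 0 < `|dx| + `|dy| + 1 by rewrite ltr_wpDl ?addr_ge0.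
have e20 : 0 < e / 2 by rewrite divr_gt0.
have inc := C1_increment dv1 dv2 c1 c2 (divr_gt0 e20 M0).
have inc' := cxy _ inc.
near=> h.
have h0 : h != 0 by near: h; exact: nbhs_dnbhs_neq.
have /= incr : `|g (x (h *: 1 + t), y (h *: 1 + t)) - g (x t, y t) -
   (g1 (x t, y t) * (x (h *: 1 + t) - x t) + g2 (x t, y t) * (y (h *: 1 + t) - y t))|
   <= e / 2 / (`|dx| + `|dy| + 1) * Num.max `|x (h *: 1 + t) - x t| `|y (h *: 1 + t) - y t|.
  by near: h; exact: inc'.
have qxb : `|qx h| <= `|dx| + `|dy| + 1.
  have : `|dx - qx h| < 1 by near: h; exact: (cvgr_dist_lt _ _ dvx _ ltr01).
  have := ler_distD dx 0 (qx h); rewrite !sub0r !normrN => ? ?.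
  by have := normr_ge0 dy; lra.
have qyb : `|qy h| <= `|dx| + `|dy| + 1.
  have : `|dy - qy h| < 1 by near: h; exact: (cvgr_dist_lt _ _ dvy _ ltr01).
  have := ler_distD dy 0 (qy h); rewrite !sub0r !normrN => ? ?.
  by have := normr_ge0 dx; lra.
have near_main : `|g1 (x t, y t) * dx + g2 (x t, y t) * dy -
   (g1 (x t, y t) * qx h + g2 (x t, y t) * qy h)| < e / 2.
  by near: h; exact: (cvgr_dist_lt _ _ main _ e20).
rewrite -[X in `|X - _|](subrK (g1 (x t, y t) * qx h + g2 (x t, y t) * qy h)) -addrA.
rewrite (le_trans (ler_normD _ _)) // [leRHS]splitr lerD ?(ltW near_main) //.
rewrite distrC.
have -> : h^-1 *: (g (x (h *: 1 + t), y (h *: 1 + t)) - g (x t, y t)) -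
   (g1 (x t, y t) * qx h + g2 (x t, y t) * qy h) = h^-1 *:
  (g (x (h *: 1 + t), y (h *: 1 + t)) - g (x t, y t) -
   (g1 (x t, y t) * (x (h *: 1 + t) - x t) + g2 (x t, y t) * (y (h *: 1 + t) - y t))).
  by rewrite /qx /qy /GRing.scale /=; ring.
rewrite normrZ (le_trans (ler_wpM2l (normr_ge0 _) incr)) //.
rewrite -[leRHS](@divfK _ (`|dx| + `|dy| + 1)) ?gt_eqF // mulrCA.
rewrite ler_wpM2l //; first by rewrite divr_ge0 ?(ltW e20) ?(ltW M0).
rewrite maxr_pMr // -!normrZ.
by rewrite ge_max; apply/andP; split.
Unshelve. all: by end_near. Qed.

End Chain.

Section Holomorphic.
Variable R : realType.
Local Notation H := (quaternion R).
Local Notation e1 := ((1, 0) : R * R).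
Local Notation e2 := ((0, 1) : R * R).
Implicit Types (f g : R * R -> H) (z w : R * R) (I J p q : H) (D : set (R * R)).

Definition conjp z : R * R := (z.1, - z.2).

(* A C^1 function f is I-holomorphic when f_x + I f_y = 0; recording f_x as f'
   makes f_y = I f'. *)
Definition hol I D f := exists f' : R * R -> H, forall z, D z ->
  [/\ is_derive z e1 f (f' z), is_derive z e2 f (I * f' z)
    & {for z, continuous f'}].

(** Pairing with the four basis quaternions recovers the coordinates, so scalar convergence
    suffices. *)
Lemma cvg_qdotP (T : Type) (F : set_system T) {FF : Filter F} (f : T -> H) q :
  (forall p, (fun x => qdot p (f x)) @ F --> qdot p q) -> f @ F --> q.
Proof.
move=> fq.
rewrite (_ : f = fun x => Quat (qre (f x)) (qi (f x)) (qj (f x)) (qk (f x))); last first.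
  by apply/funext => x; apply: quatP.
pose b0 : H := Quat 1 0 0 0; pose b1 : H := Quat 0 1 0 0.
pose b2 : H := Quat 0 0 1 0; pose b3 : H := Quat 0 0 0 1.
have qE r : r = qdot b0 r *: b0 + qdot b1 r *: b1 + qdot b2 r *: b2 + qdot b3 r *: b3.
  by apply: quatP; rewrite /qdot /=; ring.
rewrite [q]qE (_ : (fun x => _) = fun x => qdot b0 (f x) *: b0 +
  qdot b1 (f x) *: b1 + qdot b2 (f x) *: b2 + qdot b3 (f x) *: b3).
  by do ![apply: cvgD|exact: cvgZr_tmp (fq _)].
by apply/funext => x; rewrite [RHS]/= -qE; apply: quatP.
Qed.

Lemma hol_is_derive_qdot I D f p : hol I D f -> exists f' : R * R -> H,
  forall z, D z -> [/\ is_derive z e1 (fun w => qdot p (f w)) (qdot p (f' z)),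
    is_derive z e2 (fun w => qdot p (f w)) (qdot p (I * f' z)),
    {for z, continuous (fun w => qdot p (f' w))} &
    {for z, continuous (fun w => qdot p (I * f' w))}].
Proof.
move=> [f' fD]; exists f' => // z /fD[dv1 dv2 c].
split; [exact: is_derive_qdot|exact: is_derive_qdot|exact: qdot_cvg|].
by apply: qdot_cvg; apply: qmul_cvg => //; exact: cvg_cst.
Qed.

(** Partial derivatives alone do not give continuity; here it follows from [C1_increment], applied
    to each real function [qdot p (f w)]. *)
Lemma hol_continuous I D f z : open D -> hol I D f -> D z -> {for z, continuous f}.
Proof.
move=> Do Df Dz; apply: (@cvg_qdotP _ (nbhs z)) => p.
have [f' fD] := hol_is_derive_qdot p Df.
have nD : \forall w \near z, D w by exact: open_nbhs_nbhs.
have [_ _ c1 c2] := fD z Dz.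
have n1 : \forall w \near z, is_derive w e1 (fun w => qdot p (f w)) (qdot p (f' w)).
  by apply: filterS nD => w /fD[].
have n2 : \forall w \near z, is_derive w e2 (fun w => qdot p (f w)) (qdot p (I * f' w)).
  by apply: filterS nD => w /fD[].
have inc := C1_increment n1 n2 c1 c2 ltr01.
have fst_cvg : (fun w : R * R => w.1 - z.1) @ nbhs z --> 0.
  by apply/subr_cvg0; exact: cvg_fst.
have snd_cvg : (fun w : R * R => w.2 - z.2) @ nbhs z --> 0.
  by apply/subr_cvg0; exact: cvg_snd.
apply/subr_cvg0/norm_cvg0P.
pose a := qdot p (f' z); pose b := qdot p (I * f' z).
have ub : (fun w => `|w.1 - z.1| + `|w.2 - z.2| +
     `|a * (w.1 - z.1) + b * (w.2 - z.2)|) @ nbhs z --> 0.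
  rewrite (_ : 0 = `|0 : R| + `|0 : R| + `|a * 0 + b * 0|); last first.
    by rewrite !(mulr0, normr0, addr0).
  apply: cvgD; first by apply: cvgD; exact: cvg_norm.
  by apply: cvg_norm; apply: cvgD; apply: cvgM => //; exact: cvg_cst.
apply: (squeeze_cvgr _ (cvg_cst 0) ub); near=> w.
have incw : `|qdot p (f w) - qdot p (f z) - (a * (w.1 - z.1) + b * (w.2 - z.2))|
    <= 1 * Num.max `|w.1 - z.1| `|w.2 - z.2| by near: w.
rewrite normr_ge0 /=; move: incw; set u := a * _ + _ => incw.
rewrite -[X in `|X|](subrK u) (le_trans (ler_normD _ _)) // lerD2r.
rewrite (le_trans incw) //.
by rewrite mul1r ge_max lerDl lerDr !normr_ge0.
Unshelve. all: by end_near. Qed.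

Lemma hol_sub I D D' f : D' `<=` D -> hol I D f -> hol I D' f.
Proof. by move=> sub [f' fD]; exists f' => z /sub /fD. Qed.

Lemma hol_cst I D c : hol I D (fun=> c).
Proof.
exists (fun=> 0) => z _; split; first exact: is_derive_cst.
  by rewrite mulr0; exact: is_derive_cst.
exact: cvg_cst.
Qed.

Lemma hol_add I D f g : hol I D f -> hol I D g -> hol I D (fun z => f z + g z).
Proof.
move=> [f' fD] [g' gD]; exists (fun z => f' z + g' z) => z Dz.
have [f1 f2 fc] := fD z Dz; have [g1 g2 gc] := gD z Dz; split.
- exact: is_deriveD.
- by rewrite mulrDr; exact: is_deriveD.
- exact: cvgD.
Qed.

(** The y-derivative of the product is I f' g + f I g'. It equals I (f' g + f g') because [f]
    commutes with I. *)
Lemma hol_mul I D f g : open D -> (forall z, D z -> I * f z = f z * I) ->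
  hol I D f -> hol I D g -> hol I D (fun z => f z * g z).
Proof.
move=> Do If [f' fD] [g' gD]; exists (fun z => f' z * g z + f z * g' z) => z Dz.
have [f1 f2 fc] := fD z Dz; have [g1 g2 gc] := gD z Dz; split.
- exact: is_deriveqM.
- rewrite mulrDr !mulrA If // -mulrA; rewrite -[f z * I * _]mulrA.
  by rewrite mulrA; exact: is_deriveqM.
- have cf : {for z, continuous f} by apply: (@hol_continuous I D) => //; exists f'.
  have cg : {for z, continuous g} by apply: (@hol_continuous I D) => //; exists g'.
  by apply: cvgD; exact: qmul_cvg.
Qed.

Lemma qinv_comm p q : p != 0 -> q * p = p * q -> q * p^-1 = p^-1 * q.
Proof.
move=> p0 qp; rewrite -[LHS]mul1r -(qmulVr p0) -mulrA [p * _]mulrA -qp.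
by rewrite -mulrA qmulrV // mulr1.
Qed.

Lemma hol_inv I D f : open D -> (forall z, D z -> I * f z = f z * I) ->
  (forall z, D z -> f z != 0) -> hol I D f -> hol I D (fun z => (f z)^-1).
Proof.
move=> Do If f0 [f' fD]; exists (fun z => - ((f z)^-1 * f' z * (f z)^-1)) => z Dz.
have [f1 f2 fc] := fD z Dz; split.
- by apply: is_deriveqV => //; exact: f0.
- have vI : I * (f z)^-1 = (f z)^-1 * I by apply: qinv_comm; [exact: f0|exact: If].
  rewrite mulrN !mulrA vI -(mulrA _ I).
  by apply: is_deriveqV => //; exact: f0.
- have cf : {for z, continuous f} by apply: (@hol_continuous I D) => //; exists f'.
  have civ : (fun w => (f w)^-1) @ nbhs z --> (f z)^-1.
    by apply: qinv_cvg; [exact: f0|exact: cf].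
  exact: (cvgN (qmul_cvg (qmul_cvg civ fc) civ)).
Qed.

Lemma is_derive_slice_pt I z v : is_derive z v (slice_pt I) (slice_pt I v).
Proof.
apply/is_deriveP; apply: (@cvg_trans _ (cst (slice_pt I v) @ 0^')); last exact: cvg_cst.
apply: near_eq_cvg; near=> h.
have h0 : h != 0 by near: h; exact: nbhs_dnbhs_neq.
by rewrite -slice_ptB addrK slice_ptZ scalerA mulVf // scale1r.
Unshelve. all: by end_near. Qed.

Lemma hol_slice_pt I D p : hol I D (fun z => slice_pt I z - p).
Proof.
apply: (@hol_add I D (slice_pt I)); last exact: hol_cst.
exists (fun=> 1) => z _; split; last exact: cvg_cst.
  have := is_derive_slice_pt I z e1; rewrite /slice_pt /= scale0r addr0.
  by rewrite scale1r.
have := is_derive_slice_pt I z e2; rewrite /slice_pt /= scale0r add0r.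
by rewrite scale1r mulr1.
Qed.

Lemma hol_shift I D f z0 : hol I D f ->
  hol I [set w | D (w + z0)] (fun w => f (w + z0)).
Proof.
move=> [f' fD]; exists (fun w => f' (w + z0)) => w Dw.
have [/is_deriveP f1 /is_deriveP f2 fc] := fD _ Dw.
split; [apply/is_deriveP|apply/is_deriveP|].
- by under eq_fun do rewrite -addrA.
- by under eq_fun do rewrite -addrA.
- apply: (@cvg_comp _ _ _ (fun w => w + z0) f' _ (nbhs (w + z0))) => //.
  by apply: cvgD; [exact: cvg_id|exact: cvg_cst].
Qed.

Lemma is_derive_conj_e1 f z df : is_derive (conjp z) e1 f df ->
  is_derive z e1 (f \o conjp) df.
Proof.
move=> /is_deriveP dvf; apply/is_deriveP.
rewrite (_ : (fun h => _) = fun h : R => h^-1 *: (f (h *: e1 + conjp z) - f (conjp z))) //.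
apply/funext => h; congr (_ *: (f _ - _)); congr (_, _) => /=.
by rewrite /GRing.scale /= !mulr0 !add0r.
Qed.

Lemma is_derive_conj_e2 f z df : is_derive (conjp z) e2 f df ->
  is_derive z e2 (f \o conjp) (- df).
Proof.
move=> /is_deriveP dvf; apply/is_deriveP.
have opp0 : (-%R : R -> R) @ 0^' --> (0 : R)^'.
  move=> A [e /= e0 eA]; exists e => //= t te t0; apply: eA.
    by move: te; rewrite /ball_ /= !sub0r !normrN.
  by rewrite oppr_eq0.
rewrite (_ : (fun h => _) = fun h : R =>
    - ((- h)^-1 *: (f ((- h) *: e2 + conjp z) - f (conjp z)))).
  exact: (cvgN (cvg_comp _ _ opp0 dvf)).
apply/funext => h; rewrite invrN scaleNr opprK.
congr (_ *: (f _ - _)); congr (_, _) => /=.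
  by rewrite /GRing.scale /= !mulr0.
by rewrite /GRing.scale /= !mulr1 opprD.
Qed.

Lemma conjp_continuous : continuous conjp.
Proof.
move=> z.
have h1 : (fun w : R * R => w.1) @ nbhs z --> z.1 by exact: cvg_fst.
have h2 : (fun w : R * R => - w.2) @ nbhs z --> - z.2 by apply: cvgN; exact: cvg_snd.
exact: (cvg_pair h1 h2).
Qed.

(** The right side of the representation formula: the value on the line of [J] determined by the
    restriction [f] to the line of [I]. *)
Definition repr_ext I J f z : H :=
  2^-1 *: ((1 - J * I) * f z + (1 + J * I) * f (conjp z)).

(** Conjugation reverses the sign of the y-derivative, and (1 - JI) I = J (1 - JI), (1 + JI)(-I) = J
    (1 + JI). Hence both terms turn left multiplication by I into left multiplication by J. *)
Lemma hol_repr_ext I J D f : imag_unit I -> imag_unit J ->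
  (forall z, D z -> D (conjp z)) -> hol I D f -> hol J D (repr_ext I J f).
Proof.
move=> /imag_unit_sqr I1 /imag_unit_sqr J1 Dc [f' fD].
exists (repr_ext I J f') => z Dz.
have [f1 f2 fc] := fD z Dz; have [g1 g2 gc] := fD _ (Dc z Dz); split.
- apply: is_deriveZ; apply: is_deriveD; apply: is_deriveqMl => //.
  exact: is_derive_conj_e1.
- have -> : J * repr_ext I J f' z =
     2^-1 *: ((1 - J * I) * (I * f' z) + (1 + J * I) * (- (I * f' (conjp z)))).
    have c1 : (1 - J * I) * I = J * (1 - J * I).
      by rewrite mulrBl mulrBr mul1r mulr1 -mulrA I1 mulrA J1 mulrN1 mulN1r !opprK addrC.
    have c2 : (1 + J * I) * (- I) = J * (1 + J * I).
      by rewrite mulrN mulrDl mul1r -mulrA I1 mulrN1 mulrDr mulr1 mulrA J1 mulN1r opprB.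
    by rewrite /repr_ext -scalerAr mulrDr !mulrA -c1 -c2 -!mulrA mulNr.
  apply: is_deriveZ; apply: is_deriveD; apply: is_deriveqMl => //.
  exact: is_derive_conj_e2.
- have gc' : (fun w => f' (conjp w)) @ nbhs z --> f' (conjp z).
    by apply: (cvg_comp _ _ (@conjp_continuous z)).
  have cst_cvg (c : H) : (fun _ : R * R => c) @ nbhs z --> c by exact: cvg_cst.
  apply: cvgZl_tmp; apply: cvgD; first exact: (qmul_cvg (cst_cvg (1 - J * I)) fc).
  exact: (qmul_cvg (cst_cvg (1 + J * I)) gc').
Qed.

End Holomorphic.

(** * Cauchy's formula *)

Section ParametricIntegral.
Variables (R : realType) (c d : R).
Hypothesis cd : c < d.
Notation mu := (@lebesgue_measure R).
Notation cdint f := (\int[mu]_(x in `[c, d]) f x).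

Lemma cont_integrable (f : R -> R) : continuous f ->
  mu.-integrable `[c, d] (EFin \o f).
Proof.
move=> cf; apply: continuous_compact_integrable; first exact: segment_compact.
exact: continuous_subspaceT.
Qed.

Lemma int_FTC (f L : R -> R) : continuous f ->
  (forall x : R, is_derive x 1 L (f x)) -> cdint f = L d - L c.
Proof.
move=> cf dL; rewrite /Rintegral.
have cL : continuous L.
  move=> x; apply: differentiable_continuous; apply/derivable1_diffP.
  exact: ex_derive.
rewrite (@continuous_FTC2 R f L c d cd) //.
- exact: continuous_subspaceT.
- split; first by move=> x _; exact: ex_derive.
    exact/cvg_at_right_filter/cL.
  exact/cvg_at_left_filter/cL.
- by move=> x _; rewrite derive1E; exact: derive_val.
Qed.

Lemma fine_mu_itv : fine (mu `[c, d]) = d - c.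
Proof. by rewrite lebesgue_measure_itv /= lte_fin cd. Qed.

Lemma le_int_norm (f : R -> R) B : continuous f ->
  (forall x, c <= x <= d -> `|f x| <= B) -> `|cdint f| <= B * (d - c).
Proof.
move=> cf fB; rewrite -fine_mu_itv -Rintegral_cst //.
apply: le_trans (le_normr_Rintegral _ (cont_integrable cf)) _ => //.
have cfn : continuous (fun x => `|f x|) by move=> x; exact: cvg_norm (cf x).
apply: le_Rintegral => //; first exact: cont_integrable.
by apply: cont_integrable => x; exact: cvg_cst.
Qed.

(** Supplies the dominating constant for the two parametric integrals below: [K] is bounded on the
    compact rectangle over a closed interval around [a] inside the open strip. *)
Lemma rect_bound (K : R * R -> R) u v a : u < a < v ->
  (forall t x, u < t < v -> {for (t, x), continuous K}) ->
  exists u' v' M, [/\ u < u' < a, a < v' < v, 0 <= M &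
   forall t x, u' < t < v' -> c <= x <= d -> `|K (t, x)| <= M].
Proof.
move=> /andP[ua av] cK.
pose u' := (u + a) / 2; pose v' := (a + v) / 2.
have uu' : u < u' by rewrite /u'; lra.
have u'a : u' < a by rewrite /u'; lra.
have av' : a < v' by rewrite /v'; lra.
have v'v : v' < v by rewrite /v'; lra.
have cpt : compact (`[u', v']%classic `*` `[c, d]%classic).
  by apply: compact_setX; exact: segment_compact.
have cKw : {within `[u', v']%classic `*` `[c, d]%classic, continuous K}.
  apply: continuous_in_subspaceT => -[t x].
  rewrite inE => -[/=]; rewrite in_itv /= => /andP[h1 h2] _.
  by apply: cK; apply/andP; split; [exact: lt_le_trans h1|exact: le_lt_trans v'v].
have [M [_ MP]] := compact_bounded (continuous_compact cKw cpt).
exists u', v', (`|M| + 1); split; rewrite ?uu' ?av' ?addr_ge0 //.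
move=> t x /andP[h1 h2] h3.
apply: (MP (`|M| + 1)); first by rewrite ltr_pwDr ?ler_norm.
exists (t, x) => //; split=> /=; first by rewrite in_itv /= !ltW.
by rewrite in_itv.
Qed.

Lemma cont_section2 (K : R * R -> R) (t : R) :
  (forall x, {for (t, x), continuous K}) -> continuous (fun x => K (t, x)).
Proof.
move=> cK x; apply: (@cvg_comp _ _ _ (fun x : R => (t, x)) K _ (nbhs (t, x))).
  have h1 : (fun _ : R => t) @ nbhs x --> t by exact: cvg_cst.
  exact: (cvg_pair h1 cvg_id).
exact: cK.
Qed.

Lemma cont_section1 (K : R * R -> R) (t x : R) :
  {for (t, x), continuous K} -> {for t, continuous (fun s => K (s, x))}.
Proof.
move=> cK; apply: (@cvg_comp _ _ _ (fun s : R => (s, x)) K _ (nbhs (t, x))).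
  have h1 : (fun _ : R => x) @ nbhs t --> x by exact: cvg_cst.
  exact: (cvg_pair cvg_id h1).
exact: cK.
Qed.

Lemma param_int_continuous (K : R * R -> R) u v a : u < a < v ->
  (forall t x, u < t < v -> {for (t, x), continuous K}) ->
  {for a, continuous (fun t => cdint (fun x => K (t, x)))}.
Proof.
move=> uav cK; have [u' [v' [M [/andP[uu' u'a] /andP[av' v'v] M0 MP]]]] := rect_bound uav cK.
have sub t : u' < t < v' -> u < t < v.
  by move=> /andP[h1 h2]; rewrite (lt_trans uu' h1) (lt_trans h2 v'v).
have := @continuity_under_integral R _ _ mu (fun t x => K (t, x)) `[c, d]
  (measurable_itv _) u' v' _ _ (fun=> M) _ _.
apply.
- move=> t /=; rewrite in_itv /= => /sub ut.
  by apply: cont_integrable; apply: cont_section2 => x; exact: cK.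
- apply: aeW => x _ t; rewrite inE /= in_itv /= => /sub ut.
  by apply: cont_section1; exact: cK.
- by apply: cont_integrable => x; exact: cvg_cst.
- move=> t /=; rewrite in_itv /= => ut; apply: aeW => x /=.
  by rewrite in_itv /=; exact: MP.
- by rewrite inE /= in_itv /= u'a.
Qed.

(** The t-derivative of the integrand is also the x-derivative of [L], whose values at the two ends
    of the interval agree, so its integral vanishes. *)
Lemma param_int_is_derive0 (K D L : R * R -> R) u v a : u < a < v ->
  (forall t x, u < t < v -> {for (t, x), continuous K}) ->
  (forall t x, u < t < v -> {for (t, x), continuous D}) ->
  (forall t x : R, u < t < v -> is_derive t 1 (fun s => K (s, x)) (D (t, x))) ->
  (forall t x : R, u < t < v -> is_derive x 1 (fun y => L (t, y)) (D (t, x))) ->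
  (forall t, u < t < v -> L (t, c) = L (t, d)) ->
  is_derive a 1 (fun t => cdint (fun x => K (t, x))) 0.
Proof.
move=> uav cK cD dK dL Lcd.
have [u' [v' [M [/andP[uu' u'a] /andP[av' v'v] M0 MP]]]] := rect_bound uav cD.
have sub t : u' < t < v' -> u < t < v.
  by move=> /andP[h1 h2]; rewrite (lt_trans uu' h1) (lt_trans h2 v'v).
apply/is_deriveP.
have d1E t x : u < t < v -> partial1of2 (fun t x => K (t, x)) t x = D (t, x).
  by move=> ut; rewrite partial1of2E; have [] := dK t x ut.
have int0 : \int[mu]_(x in `[c, d]) partial1of2 (fun t x => K (t, x)) a x = 0.
  under eq_Rintegral do rewrite d1E //.
  have cDa : continuous (fun x => D (a, x)).
    by apply: cont_section2 => x; exact: cD.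
  have -> := int_FTC cDa (fun x => dL a x uav).
  by rewrite Lcd // subrr.
rewrite -[X in _ --> X]int0.
pose F t := cdint (fun x => K (t, x)).
rewrite (_ : (fun h => _) = (fun h => h^-1 *: (F (h + a) - F a))); last first.
  by apply/funext => h; rewrite [h *: 1]mulr1.
apply: (@cvg_differentiation_under_integral R _ _ mu (fun t x => K (t, x))
  `[c, d] (measurable_itv _) a u' v' _ _ _ (fun=> M)).
- by rewrite /= in_itv /= u'a.
- move=> t /=; rewrite in_itv /= => /sub ut.
  by apply: cont_integrable; apply: cont_section2 => x; exact: cK.
- move=> t x /=; rewrite in_itv /= => /sub ut _.
  by have [] := dK t x ut.
- by [].
- by apply: cont_integrable => x; exact: cvg_cst.
- move=> t x /=; rewrite !in_itv /= => ut xcd.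
  by rewrite d1E ?sub //; exact: MP.
Qed.

End ParametricIntegral.

(** * Quaternion-valued integrals over one period *)

Section QuaternionIntegral.
Variable R : realType.
Local Notation H := (quaternion R).
Implicit Types (f g : R -> H) (p q : H).
Local Notation mu := (@lebesgue_measure R).
Local Notation tau := (pi *+ 2 : R).

Lemma tau_gt0 : 0 < tau.
Proof. by rewrite mulrn_wgt0 // pi_gt0. Qed.

Definition qint f : H :=
  let int (g : R -> R) := \int[mu]_(x in `[0, tau]) g x in
  Quat (int (@qre R \o f)) (int (@qi R \o f)) (int (@qj R \o f)) (int (@qk R \o f)).

Lemma cont_qdot p f : continuous f -> continuous (fun x => qdot p (f x)).
Proof. by move=> cf x; apply: qdot_cvg; exact: cf. Qed.

Lemma integrable_qdot p f : continuous f ->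
  mu.-integrable `[0, tau] (EFin \o (fun x => qdot p (f x))).
Proof. by move=> cf; apply: cont_integrable; exact: cont_qdot. Qed.

(** With [qdot_ext], this reduces every identity between quaternion integrals to real integrals. *)
Lemma qdot_qint p f : continuous f ->
  qdot p (qint f) = \int[mu]_(x in `[0, tau]) qdot p (f x).
Proof.
move=> cf.
have i0 : mu.-integrable `[0, tau] (EFin \o (@qre R \o f)).
  rewrite (_ : @qre R = qdot (Quat 1 0 0 0)); first exact: integrable_qdot.
  by apply/funext => q; rewrite /qdot /=; ring.
have i1 : mu.-integrable `[0, tau] (EFin \o (@qi R \o f)).
  rewrite (_ : @qi R = qdot (Quat 0 1 0 0)); first exact: integrable_qdot.
  by apply/funext => q; rewrite /qdot /=; ring.
have i2 : mu.-integrable `[0, tau] (EFin \o (@qj R \o f)).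
  rewrite (_ : @qj R = qdot (Quat 0 0 1 0)); first exact: integrable_qdot.
  by apply/funext => q; rewrite /qdot /=; ring.
have i3 : mu.-integrable `[0, tau] (EFin \o (@qk R \o f)).
  rewrite (_ : @qk R = qdot (Quat 0 0 0 1)); first exact: integrable_qdot.
  by apply/funext => q; rewrite /qdot /=; ring.
have iZ (a : R) (g : R -> R) : mu.-integrable `[0, tau] (EFin \o g) ->
    mu.-integrable `[0, tau] (EFin \o (fun x => a * g x)).
  move=> ig; rewrite (_ : _ \o _ = (fun x => (a%:E * (EFin \o g) x)%E)).
    by apply: integrableZl.
  by apply/funext => x /=; rewrite EFinM.
have iD (g h : R -> R) : mu.-integrable `[0, tau] (EFin \o g) ->
    mu.-integrable `[0, tau] (EFin \o h) ->
    mu.-integrable `[0, tau] (EFin \o (fun x => g x + h x)).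
  move=> ig ih; rewrite (_ : _ \o _ = ((EFin \o g) \+ (EFin \o h))%E).
    by apply: (integrableD _ ig ih); exact: measurable_itv.
  by apply/funext => x /=; rewrite EFinD.
rewrite /qdot /=.
rewrite (RintegralD _ (iD _ _ (iD _ _ (iZ _ _ i0) (iZ _ _ i1)) (iZ _ _ i2)) (iZ _ _ i3)) //.
rewrite (RintegralD _ (iD _ _ (iZ _ _ i0) (iZ _ _ i1)) (iZ _ _ i2)) //.
rewrite (RintegralD _ (iZ _ _ i0) (iZ _ _ i1)) //.
by rewrite !RintegralZl.
Qed.

Lemma qint_ext f g : f =1 g -> qint f = qint g.
Proof. by move=> /funext ->. Qed.

Lemma qint_mull c f : continuous f -> qint (fun x => c * f x) = c * qint f.
Proof.
move=> cf; apply: qdot_ext => p; rewrite qdot_mulr !qdot_qint //.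
  by apply: eq_Rintegral => x _; rewrite qdot_mulr.
by move=> x; apply: qmul_cvg; [exact: cvg_cst|exact: cf].
Qed.

Lemma qintD f g : continuous f -> continuous g ->
  qint (fun x => f x + g x) = qint f + qint g.
Proof.
move=> cf cg; apply: qdot_ext => p; rewrite linearD /= !qdot_qint //.
  rewrite -(RintegralD _ (integrable_qdot _ cf) (integrable_qdot _ cg)) //.
  by apply: eq_Rintegral => x _; rewrite linearD.
by move=> x; apply: cvgD; [exact: cf|exact: cg].
Qed.

Lemma qintB f g : continuous f -> continuous g ->
  qint (fun x => f x - g x) = qint f - qint g.
Proof.
move=> cf cg; apply: qdot_ext => p; rewrite linearB /= !qdot_qint //.
  rewrite -(RintegralB _ (integrable_qdot _ cf) (integrable_qdot _ cg)) //.
  by apply: eq_Rintegral => x _; rewrite linearB.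
by move=> x; apply: cvgB; [exact: cf|exact: cg].
Qed.

Lemma qint_cst c : qint (fun=> c) = tau *: c.
Proof.
apply: qdot_ext => p; rewrite qdot_qint; last by move=> x; exact: cvg_cst.
rewrite Rintegral_cst // fine_mu_itv ?tau_gt0 // subr0 linearZ /=.
by rewrite mulrC.
Qed.

Lemma qint_sum N (f : nat -> R -> H) : (forall n, continuous (f n)) ->
  continuous (fun x => \sum_(n < N) f n x) /\
  qint (fun x => \sum_(n < N) f n x) = \sum_(n < N) qint (f n).
Proof.
move=> cf; elim: N => [|N [cN IH]].
  split; first by under eq_fun do rewrite big_ord0; move=> x; exact: cvg_cst.
  by under eq_fun do rewrite big_ord0; rewrite big_ord0 qint_cst scaler0.
under eq_fun do rewrite big_ord_recr /=.
split; first by move=> x; apply: cvgD; [exact: cN|exact: cf].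
by rewrite big_ord_recr /= qintD // IH.
Qed.

(** Testing against q = [qint f] itself gives |q|^2 = int <q, f> <= |q| B tau. *)
Lemma le_qint_norm f B : continuous f ->
  (forall x, 0 <= x <= tau -> `|f x| <= B) -> `|qint f| <= B * tau.
Proof.
move=> cf fB; have [->|q0] := eqVneq (qint f) 0.
  have B0 : 0 <= B.
    by apply: le_trans (normr_ge0 _) (fB 0 _); rewrite lexx ltW ?tau_gt0.
  by rewrite normr0 mulr_ge0 // ltW ?tau_gt0.
have n0 : 0 < `|qint f| by rewrite normr_gt0.
rewrite -(ler_pM2l n0) -expr2 -qdotqq qdot_qint //.
apply: le_trans (ler_norm _) _.
rewrite mulrA -[X in _ * X]subr0; apply: le_int_norm; first exact: tau_gt0.
  exact: cont_qdot.
move=> x /fB fxB; apply: le_trans (le_qdot _ _) _.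
by rewrite ler_wpM2l.
Qed.

End QuaternionIntegral.

Section Circle.
Variable R : realType.
Local Notation H := (quaternion R).
Local Notation tau := (pi *+ 2 : R).
Variable I : H.
Hypothesis I1 : imag_unit I.
Local Notation c := (slice_pt I).

Lemma is_derive_scalel (V : normedModType R) (a : V -> R) (x v : V) (da : R) (q : H) :
  is_derive x v a da -> is_derive x v (fun y => a y *: q) (da *: q).
Proof.
move=> /is_deriveP dva; apply/is_deriveP.
under eq_fun do rewrite -scalerBl scalerA.
by apply: cvgZr_tmp.
Qed.

(* exp(- I x), the inverse of the unit circle point: Laurent coefficients
   integrate negative powers. *)
Definition expi (x : R) : H := c (cos x, - sin x).

Lemma expiE x : expi x = (cos x)%:A + (- sin x) *: I.
Proof. by []. Qed.

Lemma is_derive_expi (x : R) : is_derive x 1 expi (- (I * expi x)).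
Proof.
have -> : - (I * expi x) = (- sin x)%:A + (- cos x) *: I.
  rewrite expiE mulrDr -!scalerAr mulr1 (imag_unit_sqr I1).
  by rewrite scalerN scaleNr opprK opprD addrC !scaleNr.
by apply: is_deriveD; apply: is_derive_scalel.
Qed.

Lemma is_derive_cont (f df : R -> H) : (forall x : R, is_derive x 1 f (df x)) ->
  continuous f.
Proof.
move=> dvf x; apply: differentiable_continuous; apply/derivable1_diffP.
exact: ex_derive.
Qed.

Lemma expi_continuous : continuous expi.
Proof. by apply: is_derive_cont => x; exact: is_derive_expi. Qed.

Lemma norm_expi x : `|expi x| = 1.
Proof. by rewrite qnorm_slice_pt //= sqrrN cos2Dsin2 sqrtr1. Qed.

Lemma expi_comm x : I * expi x = expi x * I.
Proof. by rewrite expiE mulrDr mulrDl -!scalerAr -!scalerAl mulr1 mul1r. Qed.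

Lemma is_derive_expiX n (x : R) :
  is_derive x 1 (fun y => expi y ^+ n) (- (n%:R *: (I * expi x ^+ n))).
Proof.
elim: n => [|n IH].
  rewrite scale0r oppr0; under eq_fun do rewrite expr0; exact: is_derive_cst.
under eq_fun do rewrite exprS.
have := is_deriveqM (is_derive_expi x) IH.
congr (is_derive _ _ _ _); rewrite mulNr mulrN -opprD; congr (- _).
rewrite -scalerAr !mulrA -expi_comm -!mulrA -!exprS.
by rewrite -[X in X + _]scale1r -scalerDl -natr1 addrC.
Qed.

Lemma expiX_continuous n : continuous (fun x => expi x ^+ n).
Proof. by apply: is_derive_cont => x; exact: is_derive_expiX. Qed.

Lemma expiXM_continuous n (f : R -> H) : continuous f ->
  continuous (fun x => expi x ^+ n * f x).
Proof.
by move=> cf x; apply: qmul_cvg; [exact: expiX_continuous|exact: cf].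
Qed.

(** The antiderivative I [expi]^n v / n is periodic. *)
Lemma qint_expiX n v : (0 < n)%N -> qint (fun x => expi x ^+ n * v) = 0.
Proof.
move=> n0; have cE : continuous (fun x => expi x ^+ n * v).
  by apply: expiXM_continuous => x; exact: cvg_cst.
apply: qdot_ext => p; rewrite qdot_qint //.
have n1 : n%:R != 0 :> R by rewrite pnatr_eq0 -lt0n.
pose L x := qdot p (n%:R^-1 *: I * (expi x ^+ n * v)).
have dL (x : R) : is_derive x 1 L (qdot p (expi x ^+ n * v)).
  have -> : expi x ^+ n * v = n%:R^-1 *: I * (- (n%:R *: (I * expi x ^+ n)) * v).
    rewrite mulrA mulrN -scalerAl -scalerAr scalerA mulVf // scale1r.
    by rewrite mulrA (imag_unit_sqr I1) mulN1r opprK.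
  apply: is_derive_qdot; apply: is_deriveqMl.
  have := is_deriveqM (is_derive_expiX n x) (is_derive_cst v x 1).
  by rewrite mulr0 addr0.
rewrite (int_FTC (tau_gt0 R) (cont_qdot (p := p) cE) dL).
by rewrite {1}/L /L /expi cos2pi cos0 sin0 sin2pi subrr linear0.
Qed.

Definition circ (r : R) (x : R) : R * R := (r * cos x, r * sin x).

Lemma circ_continuous r : continuous (circ r).
Proof.
move=> x.
have k : (fun=> r) @ nbhs x --> r by exact: cvg_cst.
have p1 : (fun v => r * cos v) @ nbhs x --> r * cos x.
  by apply: cvgM => //; exact: continuous_cos.
have p2 : (fun v => r * sin v) @ nbhs x --> r * sin x.
  by apply: cvgM => //; exact: continuous_sin.
exact: (cvg_pair p1 p2).
Qed.

(** Thus [expi x] / r is the inverse of the circle point, on the line of I. *)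
Lemma expi_circ r x : expi x * c (circ r x) = r%:A.
Proof.
rewrite slice_ptM // -(slice_pt_real I); congr slice_pt; congr (_, _) => /=.
  by rewrite mulNr opprK -[RHS]mulr1 -(cos2Dsin2 x); ring.
by ring.
Qed.

Lemma norm_circ r x : 0 <= r -> `|c (circ r x)| = r.
Proof.
move=> r0; rewrite qnorm_slice_pt //= !exprMn -mulrDr cos2Dsin2 mulr1.
by rewrite sqrtr_sqr ger0_norm.
Qed.

End Circle.

Section Punctured.
Variable R : realType.
Local Notation H := (quaternion R).

Definition punctured (I : H) (r : R) : set (R * R) :=
  [set w | 0 < `|slice_pt I w| < r].

Lemma near_norm_lt (I : H) (r : R) (w : R * R) : `|slice_pt I w| < r ->
  \forall v \near w, `|slice_pt I v| < r.
Proof.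
move=> wr; have c : slice_pt I @ nbhs w --> slice_pt I w by exact: slice_pt_continuous.
exact: (cvgr_norm_lt _ c).
Qed.

Lemma near_norm_gt (I : H) (r : R) (w : R * R) : r < `|slice_pt I w| ->
  \forall v \near w, r < `|slice_pt I v|.
Proof.
move=> wr; have c : slice_pt I @ nbhs w --> slice_pt I w by exact: slice_pt_continuous.
exact: (cvgr_norm_gt _ c).
Qed.

Lemma open_punctured I r : open (punctured I r).
Proof.
rewrite openE => w /andP[w0 wr]; rewrite /interior.
near=> v; apply/andP; split; near: v.
  exact: near_norm_gt.
exact: near_norm_lt.
Unshelve. all: by end_near. Qed.

Lemma is_derive_affine (a b t : R) : is_derive t 1 (fun s => (1 - s) * a + s * b) (b - a).
Proof.
apply/is_deriveP; apply: (@cvg_trans _ (cst (b - a) @ 0^')); last exact: cvg_cst.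
apply: near_eq_cvg; near=> h.
have h0 : h != 0 by near: h; exact: nbhs_dnbhs_neq.
rewrite /cst /= /GRing.scale /= mulr1.
by field.
Unshelve. all: by end_near. Qed.

Lemma is_derive_cos_affine (a b x : R) :
  is_derive x 1 (fun y => a + b * cos y) (b * - sin x).
Proof.
have := is_deriveD (is_derive_cst a x 1) (is_deriveZ b (is_derive_cos x)).
by rewrite add0r.
Qed.

Lemma is_derive_sin_affine (a b x : R) :
  is_derive x 1 (fun y => a + b * sin y) (b * cos x).
Proof.
have := is_deriveD (is_derive_cst a x 1) (is_deriveZ b (is_derive_sin x)).
by rewrite add0r.
Qed.

End Punctured.

Section Cauchy.
Variable R : realType.
Local Notation H := (quaternion R).
Local Notation tau := (pi *+ 2 : R).
Local Notation mu := (@lebesgue_measure R).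
Local Notation e1 := ((1, 0) : R * R).
Local Notation e2 := ((0, 1) : R * R).
Variables (I : H) (f : R * R -> H) (r R0 : R).
Hypothesis I1 : imag_unit I.
Local Notation c := (slice_pt I).
Hypotheses (r0 : 0 < r) (rR : r < R0).
Hypothesis hf : hol I (punctured I R0) f.
Hypothesis cf : forall w, `|c w| < R0 -> {for w, continuous f}.
Variable z : R * R.
Hypothesis zr : `|c z| < r.

Definition homot (t x : R) : R * R :=
  ((1 - t) * z.1 + t * (r * cos x), (1 - t) * z.2 + t * (r * sin x)).

(** This is zeta / (zeta - z) at zeta = [circ r x], the Cauchy kernel with respect to dx since d
    zeta = I zeta dx. Writing 1 / zeta as [expi I x] / r prepares the geometric series. *)
Definition kern (x : R) : H := (1 - r^-1 *: c z * expi I x)^-1.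

Lemma norm_W : `|r^-1 *: c z| < 1.
Proof.
by rewrite normrZ gtr0_norm ?invr_gt0 // mulrC ltr_pdivrMr // mul1r.
Qed.

Lemma kern_neq0 x : 1 - r^-1 *: c z * expi I x != 0.
Proof.
apply/eqP => /subr0_eq /(congr1 (fun q => `|q|)) /eqP.
by rewrite qnorm1 qnormM norm_expi // mulr1 gt_eqF // norm_W.
Qed.

Lemma kern_continuous : continuous kern.
Proof.
move=> x; apply: qinv_cvg; first exact: kern_neq0.
apply: cvgB; first exact: cvg_cst.
by apply: qmul_cvg; [exact: cvg_cst|exact: expi_continuous].
Qed.

Lemma kernM x : kern x * c (circ r x - z) = c (circ r x).
Proof.
have -> : c (circ r x - z) = (1 - r^-1 *: c z * expi I x) * c (circ r x).
  rewrite mulrBl mul1r -mulrA expi_circ // slice_ptB; congr (_ - _).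
  by rewrite -scalerAl -scalerAr mulr1 scalerA mulVf ?gt_eqF // scale1r.
by rewrite mulrA qmulVr ?mul1r // kern_neq0.
Qed.

Lemma homotE t x : homot t x = (1 - t) *: z + t *: circ r x.
Proof. by []. Qed.

(** The time interval reaches beyond [0, 1], so that 0 and 1 are interior points for continuity in
    t. Its margin eta satisfies (1 + 2 eta) r = R0, and |1 - t| + |t| < 1 + 2 eta. *)
Lemma homot_lt t x : - ((R0 - r) / (2 * r)) < t < 1 + (R0 - r) / (2 * r) ->
  `|c (homot t x)| < R0.
Proof.
set eta := _ / _ => /andP[t1 t2].
rewrite homotE slice_ptD !slice_ptZ (le_lt_trans (ler_normD _ _)) //.
rewrite !normrZ norm_circ ?ltW //.
have -> : R0 = (1 + 2 * eta) * r by rewrite /eta; field; rewrite gt_eqF.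
have eta0 : 0 < eta by rewrite /eta divr_gt0 ?subr_gt0 // mulr_gt0.
apply: (@le_lt_trans _ _ ((`|1 - t| + `|t|) * r)).
  by rewrite mulrDl lerD2r ler_wpM2l // ltW.
rewrite ltr_pM2r //.
by have [t0|t0] := ger0P t; have [u0|u0] := ger0P (1 - t); lra.
Qed.

Lemma homot_continuous : continuous (fun w : R * R => homot w.1 w.2).
Proof.
move=> w.
have h1 : (fun v : R * R => v.1) @ nbhs w --> w.1 by exact: cvg_fst.
have h2 : (fun v : R * R => v.2) @ nbhs w --> w.2 by exact: cvg_snd.
have k (b : R) : (fun=> b) @ nbhs w --> b by exact: cvg_cst.
have hc : (fun v : R * R => cos v.2) @ nbhs w --> cos w.2.
  exact: (cvg_comp _ _ h2 (@continuous_cos R w.2)).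
have hs : (fun v : R * R => sin v.2) @ nbhs w --> sin w.2.
  exact: (cvg_comp _ _ h2 (@continuous_sin R w.2)).
have p1 : (fun v : R * R => (1 - v.1) * z.1 + v.1 * (r * cos v.2)) @ nbhs w -->
    (1 - w.1) * z.1 + w.1 * (r * cos w.2).
  by apply: cvgD; apply: cvgM => //; [exact: cvgB|exact: cvgM].
have p2 : (fun v : R * R => (1 - v.1) * z.2 + v.1 * (r * sin v.2)) @ nbhs w -->
    (1 - w.1) * z.2 + w.1 * (r * sin w.2).
  by apply: cvgD; apply: cvgM => //; [exact: cvgB|exact: cvgM].
exact: (cvg_pair p1 p2).
Qed.

Lemma comp_homot_continuous (g : R * R -> H) t x :
  {for homot t x, continuous g} ->
  {for (t, x), continuous (fun w : R * R => g (homot w.1 w.2))}.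
Proof.
move=> cg; apply: (@cvg_comp _ _ _ (fun w : R * R => homot w.1 w.2) g _ (nbhs (homot t x))) => //.
exact: (@homot_continuous (t, x)).
Qed.

Lemma comp_snd_continuous (g : R -> H) t x :
  {for x, continuous g} -> {for (t, x), continuous (fun w : R * R => g w.2)}.
Proof.
move=> cg.
have h2 : (fun v : R * R => v.2) @ nbhs ((t, x) : R * R) --> x by exact: cvg_snd.
exact: (cvg_comp _ _ h2 cg).
Qed.

Lemma slice_circ_continuous : continuous (fun x => c (circ r x)).
Proof.
move=> x.
exact: (cvg_comp _ _ (@circ_continuous R r x) (@slice_pt_continuous R I (circ r x))).
Qed.

(** Let zeta be the circle point and w = z + t (zeta - z). The t-derivative of kern f(w) is kern
    (zeta - z) f'(w) = zeta f'(w); the x-derivative of f(w) / (t I) is also zeta f'(w), because w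
    moves with velocity t I zeta. So the integral is constant while the circle avoids the center. *)
Lemma cauchy_step p a b : 0 <= a -> a <= b -> b <= 1 ->
  (forall t x, a < t < b -> 0 < `|c (homot t x)|) ->
  \int[mu]_(x in `[0, tau]) qdot p (kern x * f (homot a x)) =
  \int[mu]_(x in `[0, tau]) qdot p (kern x * f (homot b x)).
Proof.
move=> a0 ab b1 pos.
have [f' fD] := hf.
have eta0 : 0 < (R0 - r) / (2 * r) by rewrite divr_gt0 ?subr_gt0 // mulr_gt0.
pose K (w : R * R) := qdot p (kern w.2 * f (homot w.1 w.2)).
pose D (w : R * R) := qdot p (c (circ r w.2) * f' (homot w.1 w.2)).
pose L (w : R * R) := qdot p (- (w.1^-1 *: I) * f (homot w.1 w.2)).
have cK t x : - ((R0 - r) / (2 * r)) < t < 1 + (R0 - r) / (2 * r) ->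
    {for (t, x), continuous K}.
  move=> tP; apply: qdot_cvg; apply: qmul_cvg.
    exact: (comp_snd_continuous (@kern_continuous x)).
  apply: (comp_homot_continuous (t := t) (x := x)).
  by apply: cf; exact: homot_lt.
have abP t : a <= t <= b -> - ((R0 - r) / (2 * r)) < t < 1 + (R0 - r) / (2 * r).
  by move=> /andP[? ?]; apply/andP; split; lra.
have abP' t : a < t < b -> a <= t <= b by move=> /andP[? ?]; rewrite !ltW.
have inD t x : a < t < b -> punctured I R0 (homot t x).
  by move=> tab; apply/andP; rewrite pos // homot_lt // abP ?abP'.
have cD t x : a < t < b -> {for (t, x), continuous D}.
  move=> tab; apply: qdot_cvg; apply: qmul_cvg.
    exact: (comp_snd_continuous (@slice_circ_continuous x)).
  apply: (comp_homot_continuous (t := t) (x := x)).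
  by have [] := fD _ (inD t x tab).
have nearD t x : a < t < b -> \forall w \near homot t x, punctured I R0 w.
  by move=> tab; apply: open_nbhs_nbhs; split; [exact: open_punctured|exact: inD].
(* Since f_x = f' and f_y = I f', the derivative along a curve is its velocity, read in R + I R,
   times f'. *)
have chain q t x (X Y : R -> R) (s dx dy : R) : a < t < b ->
    homot t x = (X s, Y s) ->
    is_derive s 1 X dx -> is_derive s 1 Y dy ->
    is_derive s 1 (fun u => qdot q (f (X u, Y u))) (qdot q (c (dx, dy) * f' (homot t x))).
  move=> tab hE dX dY.
  have [_ _ c'] := fD _ (inD t x tab).
  have -> : qdot q (c (dx, dy) * f' (homot t x)) =
      qdot q (f' (homot t x)) * dx + qdot q (I * f' (homot t x)) * dy.
    rewrite /slice_pt /= mulrDl -!scalerAl mul1r linearD !linearZ /=.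
    by rewrite mulrC [X in _ + X]mulrC.
  rewrite hE.
  apply: (@is_derive_chain R (fun w => qdot q (f w)) (fun w => qdot q (f' w))
    (fun w => qdot q (I * f' w)) X Y) => //;
    rewrite -?hE.
  - by apply: filterS (nearD t x tab) => w /fD[fw _ _]; exact: is_derive_qdot.
  - by apply: filterS (nearD t x tab) => w /fD[_ fw _]; exact: is_derive_qdot.
  - exact: qdot_cvg.
  - by apply: qdot_cvg; apply: qmul_cvg => //; exact: cvg_cst.
have dK (t x : R) : a < t < b -> is_derive t 1 (fun s => K (s, x)) (D (t, x)).
  move=> tab; rewrite /K /D /=.
  under eq_fun do rewrite qdot_mulr.
  rewrite -kernM -mulrA qdot_mulr.
  by apply: (chain _ _ _ (fun s => (1 - s) * z.1 + s * (r * cos x))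
    (fun s => (1 - s) * z.2 + s * (r * sin x))) => //; exact: is_derive_affine.
have dL (t x : R) : a < t < b -> is_derive x 1 (fun y => L (t, y)) (D (t, x)).
  move=> tab; rewrite /L /D /=.
  under eq_fun do rewrite qdot_mulr.
  have t0 : t != 0 by rewrite gt_eqF //; move: tab => /andP[at0 _]; exact: le_lt_trans at0.
  have -> : c (circ r x) = - (t^-1 *: I) * c (t * (r * - sin x), t * (r * cos x)).
    have -> : (t * (r * - sin x), t * (r * cos x)) = t *: cmul e2 (circ r x).
      by congr (_, _) => /=; rewrite /GRing.scale /=; ring.
    rewrite slice_ptZ -slice_ptM // -scalerAr mulNr -scalerAl scalerN scalerA divff //.
    rewrite scale1r {2}/slice_pt /= scale0r add0r scale1r mulrA (imag_unit_sqr I1).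
    by rewrite mulN1r opprK.
  rewrite -mulrA qdot_mulr.
  apply: (chain _ _ _ (fun y => (1 - t) * z.1 + t * (r * cos y))
    (fun y => (1 - t) * z.2 + t * (r * sin y))) => //.
    have := is_derive_cos_affine ((1 - t) * z.1) (t * r) x.
    by rewrite -mulrA; under eq_fun do rewrite -mulrA.
  have := is_derive_sin_affine ((1 - t) * z.2) (t * r) x.
  by rewrite -mulrA; under eq_fun do rewrite -mulrA.
pose phi t := \int[mu]_(x in `[0, tau]) K (t, x).
suff : phi b - phi a = 0 by move=> /eqP; rewrite subr_eq0 => /eqP.
(* The derivative of [phi] is 0 strictly inside; its continuity up to the ends comes from [cK],
   valid on the wider strip of [homot_lt]. *)
have [t tab||s _] := @MVT_segment R phi (fun=> 0) a b ab.
- apply: (@param_int_is_derive0 R 0 tau (tau_gt0 R) K D L a b) => //.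
    by move=> s x sab; apply: cK; rewrite abP // abP'.
  by move=> s _; rewrite /L /homot /= cos2pi cos0 sin0 sin2pi.
- apply: continuous_in_subspaceT => t; rewrite inE /= in_itv /= => tab.
  exact: (@param_int_continuous R 0 tau K _ _ t (abP _ tab) cK).
- by move=> ->; rewrite mul0r.
Qed.

End Cauchy.

(** * Power series expansion *)

Section Expansion.
Variable R : realType.
Local Notation H := (quaternion R).
Local Notation tau := (pi *+ 2 : R).
Local Notation mu := (@lebesgue_measure R).
Variables (I : H) (f : R * R -> H) (r R0 : R).
Hypothesis I1 : imag_unit I.
Local Notation c := (slice_pt I).
Hypotheses (r0 : 0 < r) (rR : r < R0).
Hypothesis hf : hol I (punctured I R0) f.
Hypothesis cf : forall w, `|c w| < R0 -> {for w, continuous f}.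

Lemma bounded_on_period (h : R -> H) : continuous h ->
  exists2 B, 0 <= B & forall x, 0 <= x <= tau -> `|h x| <= B.
Proof.
move=> ch; have cn : continuous (fun x => `|h x|) by move=> x; exact: cvg_norm (ch x).
have [||x0 _ hx] := @EVT_max R (fun x => `|h x|) 0 tau.
- exact: ltW (tau_gt0 R).
- exact: continuous_subspaceT.
- by exists `|h x0| => // x xP; apply: hx; rewrite in_itv.
Qed.

Lemma comp_circ_continuous : continuous (fun x => f (circ r x)).
Proof.
move=> x.
have cfx : f @ nbhs (circ r x) --> f (circ r x).
  by apply: cf; rewrite norm_circ ?ltW.
exact: (cvg_comp _ _ (@circ_continuous R r x) cfx).
Qed.

(** The two sides are times 0 and 1 of the homotopy. Keeping the kernel on the left avoids
    evaluating its integral: only the difference of the two sides is used later. *)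
Lemma cauchy_kern z : `|c z| < r ->
  qint (fun x => kern I r z x * f z) = qint (fun x => kern I r z x * f (circ r x)).
Proof.
move=> zr; apply: qdot_ext => p.
have ck := kern_continuous I1 r0 zr.
rewrite !qdot_qint; last 2 first.
- by move=> x; apply: qmul_cvg; [exact: ck|exact: comp_circ_continuous].
- by move=> x; apply: qmul_cvg; [exact: ck|exact: cvg_cst].
(* At time t the circle has center (1 - t) z and radius t r, so it can meet 0 only if t r = (1 - t)
   |z|, that is at t = [t0]. The homotopy is split there. *)
pose t0 := `|c z| / (r + `|c z|).
have rz : 0 < r + `|c z| by rewrite ltr_pwDl.
have t00 : 0 <= t0 by rewrite divr_ge0 // ltW.
have t01 : t0 <= 1 by rewrite ler_pdivrMr // mul1r lerDr ltW.
have h0 x : homot r z 0 x = z.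
  by rewrite homotE subr0 scale1r scale0r addr0.
have h1 x : homot r z 1 x = circ r x.
  by rewrite homotE subrr scale0r scale1r add0r.
have nh t x : 0 <= t <= 1 -> `|t * r - (1 - t) * `|c z| | <= `|c (homot r z t x)|.
  move=> /andP[ta tb].
  rewrite homotE slice_ptD !slice_ptZ.
  have -> : t * r = `|t *: c (circ r x)|.
    by rewrite normrZ norm_circ ?ltW // ger0_norm.
  have -> : (1 - t) * `|c z| = `|(1 - t) *: c z|.
    by rewrite normrZ ger0_norm // subr_ge0.
  rewrite -[X in _ - X]normrN (le_trans (ler_dist_dist _ _)) //.
  by rewrite opprK addrC.
have nz t x : 0 < t < 1 -> t != t0 -> 0 < `|c (homot r z t x)|.
  move=> /andP[ta tb] tt0; apply: lt_le_trans (nh t x _); last by rewrite !ltW.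
  rewrite normr_gt0; apply: contra tt0 => /eqP e; apply/eqP; rewrite /t0.
  apply: (mulIf (lt0r_neq0 rz)); rewrite divfK ?gt_eqF //.
  by move: e; lra.
transitivity (\int[mu]_(x in `[0, tau]) qdot p (kern I r z x * f (homot r z 0 x))).
  by apply: eq_Rintegral => x _; rewrite h0.
transitivity (\int[mu]_(x in `[0, tau]) qdot p (kern I r z x * f (homot r z 1 x))).
  transitivity (\int[mu]_(x in `[0, tau]) qdot p (kern I r z x * f (homot r z t0 x))).
    apply: (@cauchy_step R I f r R0) => // t x /andP[ta tb].
    by apply: nz; [rewrite ta (lt_le_trans tb)|rewrite lt_eqF].
  apply: (@cauchy_step R I f r R0) => // t x /andP[ta tb].
  by apply: nz; [rewrite tb (le_lt_trans t00)|rewrite gt_eqF].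
by apply: eq_Rintegral => x _; rewrite h1.
Qed.

Lemma kern_geom z N x : `|c z| < r -> kern I r z x =
  \sum_(n < N) (r^-1 *: c z) ^+ n * expi I x ^+ n +
  (r^-1 *: c z) ^+ N * (expi I x ^+ N * kern I r z x).
Proof.
move=> zr; set W := r^-1 *: c z.
have u0 := kern_neq0 I1 r0 zr x; rewrite -/W in u0.
have WE : W * expi I x = expi I x * W.
  by rewrite /W -scalerAl -scalerAr slice_ptMC.
have WX n : W ^+ n * expi I x ^+ n = (W * expi I x) ^+ n by rewrite exprMn_comm.
under eq_bigr do rewrite WX.
rewrite mulrA WX; set u := W * expi I x in u0 *.
have ku : (1 - u) * kern I r z x = 1 by rewrite /kern -/W -/u qmulrV.
have S : (1 - u) * (\sum_(n < N) u ^+ n) = 1 - u ^+ N.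
  by rewrite -opprB mulNr -subrX1 opprB.
apply: (can_inj (mulKr (x := 1 - u) _)); first by rewrite qunitE.
rewrite mulrDr S ku mulrA.
have -> : (1 - u) * u ^+ N = u ^+ N * (1 - u).
  by rewrite mulrBl mulrBr mul1r mulr1 -exprS -exprSr.
by rewrite -mulrA ku mulr1 subrK.
Qed.

Definition cauchy_coef n : H :=
  (tau^-1 * r^-1 ^+ n) *: qint (fun x => expi I x ^+ n * f (circ r x)).

Lemma cauchy_coef_bound : exists2 M, 0 <= M & forall n, `|cauchy_coef n| * r ^+ n <= M.
Proof.
have [B B0 fB] := bounded_on_period comp_circ_continuous.
exists B => // n; rewrite /cauchy_coef normrZ.
have tau0 := tau_gt0 R.
rewrite ger0_norm ?mulr_ge0 ?exprn_ge0 ?invr_ge0 ?(ltW tau0) ?(ltW r0) //.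
set v := `|_|; have -> : tau^-1 * r^-1 ^+ n * v * r ^+ n = v / tau.
  rewrite exprVn [_ * v]mulrC -!mulrA mulVf ?mulr1 // expf_neq0 //.
  by rewrite gt_eqF.
rewrite ler_pdivrMr //; apply: le_qint_norm.
  exact: (expiXM_continuous I1 comp_circ_continuous).
by move=> x /fB; rewrite qnormM qnormX norm_expi // expr1n mul1r.
Qed.

(** The kernel has integral 0 against g = f(zeta) - f(z). Expanding it by [kern_geom] makes the
    difference between a partial sum and f(z) a remainder of order |W|^(N+1), with |W| = |z| / r <
    1. *)
Lemma cauchy_series z : `|c z| < r ->
  series (fun n => c z ^+ n * cauchy_coef n) @ \oo --> f z.
Proof.
move=> zr; have tau0 := tau_gt0 R.
set W := r^-1 *: c z.
pose g x := f (circ r x) - f z.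
have cg : continuous g.
  by move=> x; apply: cvgB; [exact: comp_circ_continuous|exact: cvg_cst].
have ck := kern_continuous I1 r0 zr.
have ckg : continuous (fun x => kern I r z x * g x).
  by move=> x; apply: qmul_cvg; [exact: ck|exact: cg].
have [B B0 kB] := bounded_on_period ckg.
have k0 : qint (fun x => kern I r z x * g x) = 0.
  rewrite /g; under qint_ext do rewrite mulrBr.
  rewrite qintB; first by rewrite -cauchy_kern // subrr.
    by move=> x; apply: qmul_cvg; [exact: ck|exact: comp_circ_continuous].
  by move=> x; apply: qmul_cvg; [exact: ck|exact: cvg_cst].
have cE n (h : R -> H) : continuous h -> continuous (fun x => W ^+ n * (expi I x ^+ n * h x)).
  move=> ch x; apply: qmul_cvg; first exact: cvg_cst.
  exact: (expiXM_continuous I1 ch).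
(* The constant f(z) inside [g] contributes at n = 0 only, by [qint_expiX]; this is where the limit
   comes from. *)
have term n : qint (fun x => W ^+ n * (expi I x ^+ n * g x)) =
    tau *: (c z ^+ n * cauchy_coef n) - (if n == 0%N then tau *: f z else 0).
  rewrite qint_mull; last exact: (expiXM_continuous I1 cg).
  rewrite /g; under qint_ext do rewrite mulrBr.
  rewrite qintB; [|exact: (expiXM_continuous I1 comp_circ_continuous)|]; last first.
    by apply: (expiXM_continuous I1) => x; exact: cvg_cst.
  rewrite mulrBr; congr (_ - _).
    rewrite /cauchy_coef /W exprZn -scalerAl -!scalerAr scalerA mulrA divff ?gt_eqF //.
    by rewrite mul1r.
  case: n => [|n]; last by rewrite qint_expiX // mulr0.
  by under qint_ext do rewrite expr0 mul1r; rewrite expr0 mul1r qint_cst.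
have rem N : series (fun n => c z ^+ n * cauchy_coef n) N.+1 - f z =
    - (tau^-1 *: (W ^+ N.+1 * qint (fun x => expi I x ^+ N.+1 * (kern I r z x * g x)))).
  apply: (scalerI (lt0r_neq0 tau0)).
  rewrite scalerN scalerA divff ?gt_eqF // scale1r scalerBr.
  have [cS qS] := qint_sum N.+1 (fun n => cE n g cg).
  move: k0.
  under qint_ext => x.
    rewrite (kern_geom N.+1 x zr) -/W mulrDl mulr_suml.
    under eq_bigr do rewrite -mulrA.
    rewrite -!mulrA.
    over.
  rewrite qintD //; last exact: (cE N.+1 _ ckg).
  rewrite qS qint_mull; last exact: (expiXM_continuous I1 ckg).
  under eq_bigr do rewrite term.
  have s2 : \sum_(i < N.+1) (if i == 0%N :> nat then tau *: f z else 0) = tau *: f z.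
    by rewrite big_ord_recl /= big1 ?addr0.
  rewrite sumrB s2 -scaler_sumr /series /= big_mkord => /eqP.
  by rewrite addr_eq0 => /eqP.
rewrite -cvg_shiftS.
apply/subr_cvg0/norm_cvg0P.
have W1 : `|W| < 1 by exact: norm_W.
have ub : (fun N => `|W| ^+ N.+1 * B) @ \oo --> (0 : R).
  have W0 : (fun n => `|W| ^+ n.+1) @ \oo --> (0 : R).
    by rewrite (cvg_shiftS (fun n => `|W| ^+ n)); apply: cvg_expr; rewrite normr_id.
  rewrite -[X in _ --> X](mul0r B).
  by apply: cvgM => //; exact: cvg_cst.
apply: (squeeze_cvgr _ (cvg_cst 0) ub); near=> N.
rewrite normr_ge0 /= rem normrN normrZ gtr0_norm ?invr_gt0 // qnormM qnormX.
rewrite mulrCA ler_wpM2l ?exprn_ge0 // mulrC ler_pdivrMr //.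
apply: le_qint_norm; first exact: (expiXM_continuous I1 ckg).
by move=> x /kB kx; rewrite qnormM qnormX norm_expi // expr1n mul1r.
Unshelve. all: by end_near. Qed.

End Expansion.

(** * Leading terms and uniqueness of power series *)

Section PowerSeries.
Variable R : realType.
Local Notation H := (quaternion R).
Implicit Types (a : nat -> H) (I J p q u : H) (r M : R).

Lemma qcvg_unique (T : Type) (F : set_system T) {FF : ProperFilter F} (f : T -> H) p q :
  f @ F --> p -> f @ F --> q -> p = q.
Proof. by move=> fp fq; apply: (cvg_unique (@norm_hausdorff R H) fp fq). Qed.

Lemma le_norm_cvg (v : nat -> H) p q (C : R) (N : nat) : v @ \oo --> p ->
  (forall n, (N <= n)%N -> `|v n - q| <= C) -> `|p - q| <= C.
Proof.
move=> vp vC.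
have h : (fun n => `|v n - q|) @ \oo --> `|p - q|.
  by apply: cvg_norm; apply: cvgB => //; exact: cvg_cst.
apply: (cvgr_to_le h); near=> n; apply: vC; near: n.
exact: nbhs_infty_ge.
Unshelve. all: by end_near. Qed.

Lemma geom_sum_le (x : R) k : 0 <= x <= 1 / 2 -> \sum_(j < k) x ^+ j <= 2.
Proof.
move=> /andP[x0 x2].
have := subrX1 x k; set S := \sum_(_ < _) _ => e.
have xk : 0 <= x ^+ k by rewrite exprn_ge0.
have S0 : 0 <= S by apply: sumr_ge0 => i _; rewrite exprn_ge0.
nra.
Qed.

(** The terms are at most M (|u| / r)^n. On the half disc the ratio is at most 1/2, so the tail is
    at most twice its first bound. This serves both uniqueness and the lower bound for 1/N. *)
Lemma lead_bound a r M m u s : 0 < r -> 0 <= M ->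
  (forall n, `|a n| * r ^+ n <= M) -> (forall n, (n < m)%N -> a n = 0) ->
  `|u| <= r / 2 -> series (fun n => u ^+ n * a n) @ \oo --> s ->
  `|s - u ^+ m * a m| <= 2 * M * (`|u| / r) ^+ m.+1.
Proof.
move=> r0 M0 aM am ur sC.
apply: (le_norm_cvg (N := m.+1) sC) => n mn.
rewrite -(subnKC mn) /series /= big_mkord big_split_ord /=.
rewrite big_ord_recr /= big1 ?add0r; last by move=> i _; rewrite am ?mulr0.
rewrite addrAC subrr add0r.
apply: le_trans (ler_norm_sum _ _ _) _.
set x := `|u| / r.
have x0 : 0 <= x by rewrite divr_ge0 // ltW.
have x2 : x <= 1 / 2 by rewrite ler_pdivrMr // mul1r mulrC.
apply: (@le_trans _ _ (\sum_(i < n - m.+1) M * x ^+ m.+1 * x ^+ i)).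
  apply: ler_sum => i _; rewrite qnormM qnormX -mulrA -exprD.
  rewrite expr_div_n mulrA ler_pdivlMr ?exprn_gt0 // -mulrA mulrC.
  by rewrite ler_wpM2r // exprn_ge0.
rewrite -mulr_sumr -[2 * M * _]mulrA [leRHS]mulrC.
apply: ler_wpM2l; first by rewrite mulr_ge0 // exprn_ge0.
by apply: geom_sum_le; rewrite x0.
Qed.

Lemma series_unique0 a r M d : 0 < r -> 0 <= M -> 0 < d ->
  (forall n, `|a n| * r ^+ n <= M) ->
  (forall t : R, 0 < t < d -> series (fun n => (t%:A : H) ^+ n * a n) @ \oo --> (0 : H)) ->
  forall n, a n = 0.
Proof.
move=> r0 M0 d0 aM a0 n.
elim/ltn_ind: n => m IH.
apply/eqP; rewrite -normr_le0 leNgt; apply/negP => am0.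
(* The tail at [t] is t^m (C t). The last bound in the choice of [t] forces C t <= |a m| / 2,
   against |a m| <= C t. *)
pose C := 2 * M / r ^+ m.+1.
have C0 : 0 <= C by rewrite divr_ge0 ?exprn_ge0 ?mulr_ge0 // ltW.
pose t := Num.min (Num.min (d / 2) (r / 2)) (`|a m| / (2 * (C + 1))).
have C1 : 0 < C + 1 by rewrite ltr_wpDl.
have t0 : 0 < t by rewrite !lt_min !divr_gt0 // mulr_gt0.
have td : t <= d / 2 by rewrite !ge_min lexx.
have tr : t <= r / 2 by rewrite !ge_min lexx orbT.
have tC : t <= `|a m| / (2 * (C + 1)) by rewrite !ge_min lexx !orbT.
have nt : `|t%:A : H| = t by rewrite normrZ qnorm1 mulr1 gtr0_norm.
have := @lead_bound a r M m (t%:A) 0 r0 M0 aM (fun k km => IH k km) _ (a0 t _).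
rewrite nt t0 tr sub0r normrN qnormM qnormX nt => /(_ isT).
have -> : t < d by lra.
move=> /(_ isT).
have -> : 2 * M * (t / r) ^+ m.+1 = t ^+ m * (C * t).
  by rewrite /C expr_div_n exprS; ring.
rewrite ler_pM2l ?exprn_gt0 // => le1.
have : `|a m| <= (C + 1) * (`|a m| / (2 * (C + 1))).
  apply: le_trans le1 _; apply: ler_pM => //; first exact: ltW.
  by rewrite lerDl.
have -> : (C + 1) * (`|a m| / (2 * (C + 1))) = `|a m| / 2.
  by field; rewrite gt_eqF.
by move=> ?; lra.
Qed.

End PowerSeries.

(** * Expansion of a bounded holomorphic function on a punctured disc *)

Section Removable.
Variable R : realType.
Local Notation H := (quaternion R).
Implicit Types (I : H).

Lemma slice_pt_comm I z : imag_unit I -> I * slice_pt I z = slice_pt I z * I.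
Proof.
by move=> I1; rewrite /slice_pt mulrDr mulrDl -!scalerAr -!scalerAl mulr1 mul1r.
Qed.

(** The product z f(z) tends to 0 at the center and takes the value 0 there whatever f(0) is, so the
    expansion on a full disc applies to it. Its constant coefficient vanishes, and dividing by z
    shifts the others by one. *)
Lemma removable I (f : R * R -> H) (r R0 B : R) : imag_unit I ->
  0 < r -> r < R0 -> hol I (punctured I R0) f ->
  (forall z, punctured I R0 z -> `|f z| <= B) ->
  exists a : nat -> H, exists2 M, 0 <= M &
    (forall n, `|a n| * r ^+ n <= M) /\
    forall z, punctured I r z -> series (fun n => slice_pt I z ^+ n * a n) @ \oo --> f z.
Proof.
move=> I1 r0 rR hf fB.
pose g z := slice_pt I z * f z.
have op : open (punctured I R0) by exact: open_punctured.
have hg : hol I (punctured I R0) g.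
  rewrite /g; apply: hol_mul => //; first by move=> z _; exact: slice_pt_comm.
  have := @hol_slice_pt R I (punctured I R0) 0.
  by under eq_fun do rewrite subr0.
have cg w : `|slice_pt I w| < R0 -> {for w, continuous g}.
  move=> wR; have [w0|w0] := eqVneq (slice_pt I w) 0; last first.
    by apply: (hol_continuous op hg); rewrite /punctured /= wR normr_gt0 w0.
  have gw : g w = 0 by rewrite /g w0 mul0r.
  suff : g @ nbhs w --> (0 : H) by rewrite -gw.
  have cw : (fun v => `|slice_pt I v| * `|B|) @ nbhs w --> (0 : R).
    have h : (fun v => `|slice_pt I v|) @ nbhs w --> `|slice_pt I w|.
      exact: (cvg_norm (@slice_pt_continuous R I w)).
    rewrite -[X in _ --> X](mul0r `|B|) -(normr0 H) -w0.
    by apply: cvgM => //; exact: cvg_cst.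
  apply/norm_cvg0P; apply: (squeeze_cvgr _ (cvg_cst 0) cw).
  near=> v; rewrite normr_ge0 /= qnormM.
  have [v0|v0] := eqVneq (slice_pt I v) 0; first by rewrite v0 normr0 !mul0r.
  rewrite ler_wpM2l // (le_trans (fB v _)) ?ler_norm //.
  rewrite /punctured /= normr_gt0 v0 /=.
  by near: v; exact: near_norm_lt.
pose b := cauchy_coef I g r.
have [M M0 bM] := cauchy_coef_bound I1 r0 rR cg.
have bS z := @cauchy_series R I g r R0 I1 r0 rR hg cg z.
have b0 : b 0%N = 0.
  have := bS 0; rewrite slice_pt0 normr0 => /(_ r0).
  rewrite /g slice_pt0 mul0r => h0.
  (* At z = 0 only the term of index 0 survives, as 0^0 = 1; the shift skips the empty partial
     sum. *)
  have h1 : (fun N => series (fun n => (0 : H) ^+ n * b n) N.+1) @ \oo --> (0 : H).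
    by rewrite (cvg_shiftS (series (fun n => (0 : H) ^+ n * b n))).
  have e : (fun N => series (fun n => (0 : H) ^+ n * b n) N.+1) = (fun=> b 0%N).
    apply/funext => N; rewrite /series /= big_mkord big_ord_recl /= mul1r.
    by rewrite big1 ?addr0 // => i _; rewrite exprS !mul0r.
  rewrite e in h1.
  by apply: (qcvg_unique _ h1); exact: cvg_cst.
exists (fun n => b n.+1), (M / r); first by rewrite divr_ge0 // ltW.
split=> [n|z /andP[z0 zr]].
  by rewrite ler_pdivlMr // -mulrA -exprSr.
have cz0 : slice_pt I z != 0 by rewrite -normr_gt0.
have h : (fun N => series (fun n => slice_pt I z ^+ n * b n) N.+1) @ \oo --> g z.
  by rewrite (cvg_shiftS (series (fun n => slice_pt I z ^+ n * b n))); exact: bS.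
have -> : f z = (slice_pt I z)^-1 * g z by rewrite /g mulrA qmulVr // mul1r.
rewrite (_ : series _ = fun N =>
    (slice_pt I z)^-1 * series (fun n => slice_pt I z ^+ n * b n) N.+1).
  by apply: qmul_cvg => //; exact: cvg_cst.
apply/funext => N.
rewrite /series /= !big_mkord big_ord_recl /= b0 mulr0 add0r mulr_sumr.
by apply: eq_bigr => i _; rewrite exprS !mulrA qmulVr // mul1r.
Unshelve. all: by end_near. Qed.

End Removable.

(** * Identity principle and representation formula *)

Section Identity.
Variable R : realType.
Local Notation H := (quaternion R).
Variable I : H.
Hypothesis I1 : imag_unit I.
Local Notation c := (slice_pt I).
Implicit Types (D : set (R * R)) (f : R * R -> H) (z w v : R * R).

(** Neighborhoods in R^2 are given by squares, while power series live on Euclidean discs. *)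
Lemma slice_ball_nbhs z (P : set (R * R)) :
  (\forall w \near z, P w) <->
  exists2 e : R, 0 < e & forall v, `|c v| < e -> P (v + z).
Proof.
split=> [/near_prod_ball[e e0 zP]|[e e0 zP]].
  have le1 v : `|v.1| <= `|c v| /\ `|v.2| <= `|c v|.
    rewrite qnorm_slice_pt // -!sqrtr_sqr !ler_sqrt ?addr_ge0 ?sqr_ge0 //.
    by rewrite lerDl lerDr !sqr_ge0.
  exists e => // v ve; case: z zP => z1 z2 zP; have [v1 v2] := le1 v.
  by apply: zP => /=; rewrite addrK; exact: le_lt_trans ve.
have nz : \forall w \near z, `|c (w - z)| < e.
  have h : (fun w => c (w - z)) @ nbhs z --> c 0.
    have h1 : (fun w : R * R => w - z) @ nbhs z --> (0 : R * R).
      by apply/subr_cvg0; exact: cvg_id.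
    exact: (cvg_comp _ _ h1 (@slice_pt_continuous R I 0)).
  by apply: (cvgr_norm_lt _ h); rewrite slice_pt0 normr0.
by apply: filterS nz => w we; rewrite -(subrK z w); exact: zP.
Qed.

(** Vanishing on a real segment starting at the center kills all Taylor coefficients, by
    [series_unique0]. The radius [r] of the circle of integration lies between |v| and [rho]. *)
Lemma local_zero D f z (rho d : R) : open D -> hol I D f ->
  (forall v, `|c v| < rho -> D (v + z)) -> 0 < d ->
  (forall t : R, 0 < t < d -> f ((t, 0) + z) = 0) ->
  forall v, `|c v| < rho -> f (v + z) = 0.
Proof.
move=> Do Df zD d0 f0 v vrho.
pose r := (`|c v| + rho) / 2.
have r0 : 0 < r by have := normr_ge0 (c v); rewrite /r; lra.
have rr : r < rho by rewrite /r; lra.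
have vr : `|c v| < r by rewrite /r; lra.
pose g w := f (w + z).
have Dg : hol I [set w | D (w + z)] g by exact: hol_shift.
have pD : punctured I rho `<=` [set w | D (w + z)] by move=> w /andP[_ /zD].
have hg := hol_sub pD Dg.
have cg w : `|c w| < rho -> {for w, continuous g}.
  move=> wr; have cf := hol_continuous Do Df (zD w wr).
  have h1 : (fun w => w + z) @ nbhs w --> w + z.
    by apply: cvgD; [exact: cvg_id|exact: cvg_cst].
  exact: (cvg_comp _ _ h1 cf).
have S := @cauchy_series R I g r rho I1 r0 rr hg cg.
have [M M0 aM] := cauchy_coef_bound I1 r0 rr cg.
have a0 : forall n, cauchy_coef I g r n = 0.
  apply: (@series_unique0 R _ r M (Num.min d r) r0 M0 _ aM); first by rewrite lt_min d0.
  move=> t /andP[t0]; rewrite lt_min => /andP[td tr].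
  have := S (t, 0); rewrite slice_pt_real /g f0 ?t0 //; apply.
  by rewrite normrZ qnorm1 mulr1 gtr0_norm.
have := S v vr; rewrite (_ : series _ = fun=> 0).
  by move=> h; apply: (qcvg_unique h); exact: cvg_cst.
apply/funext => N; rewrite /series /= big1 // => i _.
by rewrite a0 mulr0.
Qed.

Lemma hol_identity D f (x0 : R) : open D -> connected D -> hol I D f ->
  D (x0, 0) -> (forall x, D (x, 0) -> f (x, 0) = 0) -> forall z, D z -> f z = 0.
Proof.
move=> Do Dc Df Dx0 f0.
(* The interior of the zero set: it is open by construction, so what remains is that it meets D and
   is relatively closed. *)
pose Z : set (R * R) := [set z | \forall w \near z, f w = 0].
have Zo : open Z.
  rewrite openE => z; rewrite /Z /= => /near_join //.
suff ZD : D `&` Z = D by move=> z; rewrite -ZD => -[_ /nbhs_singleton].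
apply: Dc.
- exists (x0, 0); split=> //.
  have /slice_ball_nbhs[e e0 eD] : \forall w \near (x0, 0), D w.
    exact: open_nbhs_nbhs.
  apply/slice_ball_nbhs; exists e => //.
  apply: (@local_zero D f (x0, 0) e e) => // t /andP[t0 te].
  have -> : (t, 0) + (x0, 0) = (t + x0, 0) :> R * R by congr (_, _); rewrite /= addr0.
  apply: f0; have := eD (t, 0); rewrite slice_pt_real normrZ qnorm1 mulr1 gtr0_norm //.
  move=> /(_ te); congr D.
  by congr (_, _); rewrite /= addr0.
- by exists Z.
- exists (closure (D `&` Z)); first exact: closed_closure.
  apply/seteqP; split=> [z DZ|z [Dz cl]].
    by split; [case: DZ|exact: subset_closure].
  split=> //.
  have /slice_ball_nbhs[e e0 eD] : \forall w \near z, D w.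
    exact: open_nbhs_nbhs.
  (* A point z' of [Z] is taken within e / 3 of z: the disc of radius 2e / 3 about z' lies in D and
     contains the disc of radius e / 3 about z. *)
  have e3 : 0 < e / 3 by rewrite divr_gt0.
  have nz : nbhs z [set w | `|c (w - z)| < e / 3].
    by apply/slice_ball_nbhs; exists (e / 3) => // v; rewrite /= addrK.
  have [z' [[Dz' Zz'] /= z'z]] := cl _ nz.
  have /slice_ball_nbhs[d d0 dP] := Zz'.
  have zero : forall v, `|c v| < 2 / 3 * e -> f (v + z') = 0.
    apply: (@local_zero D f z' _ d) => //.
    - move=> v ve; rewrite -(subrK z z') addrA; apply: eD.
      rewrite slice_ptD (le_lt_trans (ler_normD _ _)) //; lra.
    - move=> t /andP[t0 td]; apply: dP.
      by rewrite slice_pt_real normrZ qnorm1 mulr1 gtr0_norm.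
  apply/slice_ball_nbhs; exists (e / 3) => // v ve.
  rewrite -[z](subKr z') addrA; have -> : v + z' - (z' - z) = (v - (z' - z)) + z'.
    by rewrite addrAC.
  apply: zero; rewrite slice_ptB (le_lt_trans (ler_normB _ _)) //; lra.
Qed.

End Identity.

(** * From regularity to the representation formula *)

Section Representation.
Variable R : realType.
Local Notation H := (quaternion R).
Local Notation e1 := ((1, 0) : R * R).
Local Notation e2 := ((0, 1) : R * R).
Implicit Types (I J : H) (A : set H) (f g : H -> H).

Lemma regular_hol A f I : regular_on A f -> imag_unit I ->
  hol I (slice A I) (f \o slice_pt I).
Proof.
move=> rf I1; exists ('D_e1 (f \o slice_pt I)) => z Az.
have [d1 d2 c1 c2 /eqP] := rf I I1 z Az.
rewrite scaler_eq0 invr_eq0 pnatr_eq0 /= addr_eq0 => /eqP cr.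
have e : 'D_e2 (f \o slice_pt I) z = I * 'D_e1 (f \o slice_pt I) z.
  by rewrite cr mulrN mulrA (imag_unit_sqr I1) mulN1r opprK.
split; last exact: c1.
  by apply: DeriveDef; [exact: d1|reflexivity].
by rewrite -e; apply: DeriveDef; [exact: d2|reflexivity].
Qed.

Lemma hol_regular A g : (forall I, imag_unit I -> open (slice A I)) ->
  (forall I, imag_unit I -> hol I (slice A I) (g \o slice_pt I)) -> regular_on A g.
Proof.
move=> Ao gh I I1 fI z Az; have [f' fD] := gh I I1.
have nA : \forall w \near z, slice A I w.
  by apply: open_nbhs_nbhs; split=> //; exact: Ao.
have [d1 d2 c'] := fD z Az; split.
- exact: ex_derive.
- exact: ex_derive.
- have e : {near z, f' =1 'D_e1 fI}.
    by apply: filterS nA => w /fD[dw _ _]; rewrite derive_val.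
  have e0 : 'D_e1 fI z = f' z by rewrite derive_val.
  have h : f' @ nbhs z --> f' z by exact: c'.
  rewrite -e0 in h; exact: cvg_trans (near_eq_cvg e) h.
- have e : {near z, (fun w => I * f' w) =1 'D_e2 fI}.
    by apply: filterS nA => w /fD[_ dw _]; rewrite derive_val.
  have e0 : 'D_e2 fI z = I * f' z by rewrite derive_val.
  have h : (fun w => I * f' w) @ nbhs z --> I * f' z.
    by apply: qmul_cvg; [exact: cvg_cst|exact: c'].
  rewrite -e0 in h; exact: cvg_trans (near_eq_cvg e) h.
- rewrite !derive_val mulrA (imag_unit_sqr I1) mulN1r subrr scaler0 //.
Qed.

Lemma slice_symmetric A I J z : symmetric_set A -> imag_unit I -> imag_unit J ->
  slice A I z -> slice A J z.
Proof. by move=> sA I1 J1 Az; case: z Az => x y /(sA _ _ _ I1); apply; exists J. Qed.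

Lemma slice_conjp A I z : symmetric_set A -> imag_unit I ->
  slice A I z -> slice A I (conjp z).
Proof.
move=> sA I1 /(slice_symmetric sA I1 (imag_unitN I1)).
by rewrite /slice /= slice_ptN.
Qed.

(** Both sides are J-holomorphic on the slice of [J]. They agree at real points, where conjugation
    is trivial and (1 - JI) + (1 + JI) = 2; the identity principle does the rest. *)
Lemma representation A f I J z : slice_domain A -> symmetric_set A ->
  regular_on A f -> imag_unit I -> imag_unit J -> slice A I z ->
  f (slice_pt J z) = repr_ext I J (f \o slice_pt I) z.
Proof.
move=> [_ _ [x0 Ax0] Asl] sA rf I1 J1 Az.
have [Jo Jc] := Asl J J1.
have hJ := regular_hol rf J1.
have hI : hol J (slice A J) (repr_ext I J (f \o slice_pt I)).
  apply: hol_repr_ext => //; first by move=> w; exact: slice_conjp.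
  have : slice A J `<=` slice A I by move=> w; exact: slice_symmetric.
  by move=> /hol_sub; apply; exact: regular_hol.
pose h w := f (slice_pt J w) + (- 1) * repr_ext I J (f \o slice_pt I) w.
have hh : hol J (slice A J) h.
  apply: hol_add => //; apply: hol_mul => //; last exact: hol_cst.
  by move=> w _; rewrite mulrN1 mulN1r.
have h0 : h z = 0.
  apply: (hol_identity J1 (x0 := x0) Jo Jc hh).
  - by rewrite /slice /= slice_pt_real.
  - move=> x _; rewrite /h /repr_ext /conjp /= oppr0 !slice_pt_real -mulrDl.
    have -> : 1 - J * I + (1 + J * I) = 2%:R by rewrite addrACA addNr addr0.
    by rewrite mulr_natl -(scaler_nat 2 (f _)) scalerA mulVf ?pnatr_eq0 // scale1r mulN1r subrr.
  - exact: slice_symmetric Az.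
by apply/eqP; rewrite -subr_eq0 -h0 /h mulN1r.
Qed.

End Representation.

(** * Symmetrization *)

Section Stem.
Variable R : realType.
Local Notation H := (quaternion R).
Local Notation e1 := ((1, 0) : R * R).
Local Notation e2 := ((0, 1) : R * R).
Implicit Types (I J A B p q : H) (F : R * R -> H).

(** [stem_re] and [stem_im] are the A and B of the representation formula, computed from the
    restriction [F] to the line of [I]. *)
Definition stem_re F z : H := 2^-1 *: (F z + F (conjp z)).
Definition stem_im I F z : H := 2^-1 *: (I * (F (conjp z) - F z)).

Lemma repr_ext_stem I J F z :
  repr_ext I J F z = stem_re F z + J * stem_im I F z.
Proof.
rewrite /repr_ext /stem_re /stem_im -scalerAr -scalerDr; congr (_ *: _).
rewrite mulrBl mulrDl !mul1r !mulrBr !mulrA.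
by rewrite addrACA [- _ + _]addrC.
Qed.

Lemma repr_ext_id I F z : imag_unit I -> repr_ext I I F z = F z.
Proof.
move=> I1; rewrite /repr_ext (imag_unit_sqr I1) opprK addrN mul0r addr0.
rewrite (_ : 1 + 1 = 2%:R) // mulr_natl -(scaler_nat 2 (F z)) scalerA.
by rewrite mulVf ?pnatr_eq0 // scale1r.
Qed.

(** The complex number <p, A> + I <p, B>, a component of the pair (A, B). *)
Definition stem_coord I F p z : H :=
  slice_pt I (qdot p (stem_re F z), qdot p (stem_im I F z)).

(** The functions A and B satisfy A_x = B_y and A_y = - B_x; pairing with a constant [p] preserves
    these equations. *)
Lemma hol_stem_coord I F D p : imag_unit I -> (forall z, D z -> D (conjp z)) ->
  hol I D F -> hol I D (stem_coord I F p).
Proof.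
move=> I1 Dc [F' FD].
have II := imag_unit_sqr I1.
exists (stem_coord I F' p) => z Dz.
have [d1 d2 c1] := FD z Dz; have [g1 g2 c2] := FD _ (Dc z Dz).
have a1 : is_derive z e1 (stem_re F) (stem_re F' z).
  by apply: is_deriveZ; apply: is_deriveD => //; exact: is_derive_conj_e1.
have a2 : is_derive z e2 (stem_re F) (- stem_im I F' z).
  have -> : - stem_im I F' z = 2^-1 *: (I * F' z + - (I * F' (conjp z))).
    by rewrite /stem_im -scalerN mulrBr opprB.
  by apply: is_deriveZ; apply: is_deriveD => //; exact: is_derive_conj_e2.
have b1 : is_derive z e1 (stem_im I F) (stem_im I F' z).
  apply: is_deriveZ; apply: is_deriveqMl; apply: is_deriveB => //.
  exact: is_derive_conj_e1.
have b2 : is_derive z e2 (stem_im I F) (stem_re F' z).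
  have -> : stem_re F' z = 2^-1 *: (I * (- (I * F' (conjp z)) - I * F' z)).
    rewrite /stem_re; congr (_ *: _).
    by rewrite mulrBr mulrN !mulrA II !mulN1r !opprK addrC.
  apply: is_deriveZ; apply: is_deriveqMl; apply: is_deriveB => //.
  exact: is_derive_conj_e2.
have pair (a b : R * R -> R) v da db : is_derive z v a da -> is_derive z v b db ->
    is_derive z v (fun w => slice_pt I (a w, b w)) (slice_pt I (da, db)).
  by move=> ? ?; apply: is_deriveD; exact: is_derive_scalel.
split.
- by apply: pair; exact: is_derive_qdot.
- have -> : I * stem_coord I F' p z =
      slice_pt I (qdot p (- stem_im I F' z), qdot p (stem_re F' z)).
    rewrite /stem_coord /slice_pt /= mulrDr -!scalerAr mulr1 II.
    by rewrite scalerN -scaleNr addrC; congr (_ *: _ + _); rewrite linearN.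
  by apply: pair; exact: is_derive_qdot.
- have cF : F' @ nbhs z --> F' z by exact: c1.
  have cFc : (fun w => F' (conjp w)) @ nbhs z --> F' (conjp z).
    exact: (cvg_comp _ _ (@conjp_continuous R z) c2).
  have ca : stem_re F' @ nbhs z --> stem_re F' z.
    by apply: cvgZl_tmp; exact: cvgD.
  have cb : stem_im I F' @ nbhs z --> stem_im I F' z.
    by apply: cvgZl_tmp; apply: qmul_cvg; [exact: cvg_cst|exact: cvgB].
  have qa := qdot_cvg (p := p) ca; have qb := qdot_cvg (p := p) cb.
  have : stem_coord I F' p @ nbhs z --> stem_coord I F' p z.
    by apply: cvgD; apply: cvgZr_tmp; exact: qdot_cvg.
  by [].
Qed.

Definition stem_norm I F z : H := slice_pt I
  (`|stem_re F z| ^+ 2 - `|stem_im I F z| ^+ 2,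
   2 * qdot (stem_re F z) (stem_im I F z)).

(** This sum of squares is what makes N holomorphic: the components lie in R + I R, hence commute
    with I. *)
Lemma stem_normE I F z : imag_unit I -> stem_norm I F z =
  stem_coord I F (Quat 1 0 0 0) z * stem_coord I F (Quat 1 0 0 0) z +
  stem_coord I F (Quat 0 1 0 0) z * stem_coord I F (Quat 0 1 0 0) z +
  stem_coord I F (Quat 0 0 1 0) z * stem_coord I F (Quat 0 0 1 0) z +
  stem_coord I F (Quat 0 0 0 1) z * stem_coord I F (Quat 0 0 0 1) z.
Proof.
move=> I1; rewrite /stem_norm /stem_coord !slice_ptM // -!slice_ptD.
congr slice_pt; rewrite -!qdotqq.
by congr (_, _) => /=; rewrite /qdot /=; ring.
Qed.

Lemma hol_stem_norm I F D : imag_unit I -> open D -> (forall z, D z -> D (conjp z)) ->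
  hol I D F -> hol I D (stem_norm I F).
Proof.
move=> I1 Do Dc hF.
rewrite (funext (fun z => stem_normE F z I1) : stem_norm I F = _).
have sq p : hol I D (fun z => stem_coord I F p z * stem_coord I F p z).
  apply: hol_mul => //; try exact: hol_stem_coord.
  by move=> z _; exact: slice_pt_comm.
by do 3![apply: hol_add => //].
Qed.

(* The values A + J B, J ranging over the imaginary units, have square norm
   s + 2 <J, A conj(B)> with s = |A|^2 + |B|^2; the product of their least and
   greatest square norms is s^2 - 4 |Im (A conj(B))|^2, the squared norm of the
   symmetrization. *)
Lemma sphere_min_max I A B (e : R) : 0 < e -> imag_unit I ->
  (forall J, imag_unit J -> e <= `|A + J * B|) ->
  let n2 := (`|A| ^+ 2 - `|B| ^+ 2) ^+ 2 + (2 * qdot A B) ^+ 2 in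
  e ^+ 2 * e ^+ 2 <= n2 /\ e ^+ 2 * `|A + I * B| ^+ 2 <= n2.
Proof.
move=> e0 I1 eAB n2.
pose C := A * quat_conj B.
pose v : H := Quat 0 (qi C) (qj C) (qk C).
pose s := `|A| ^+ 2 + `|B| ^+ 2.
have n2E : n2 = s ^+ 2 - 4 * `|v| ^+ 2.
  by rewrite /n2 /s !qnorm_sqr /v /C /sqnorm /qdot /=; ring.
have nJ J : imag_unit J -> `|A + J * B| ^+ 2 = s + 2 * qdot J v.
  move=> J1; have /imag_unitE[J0 _] := J1.
  have -> : `|A + J * B| ^+ 2 = `|A| ^+ 2 + `|J * B| ^+ 2 + 2 * qdot A (J * B).
    by rewrite !qnorm_sqr /sqnorm /qdot /=; ring.
  rewrite qnormM (qnorm_imag_unit J1) mul1r /s; congr (_ + _ * _).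
  by rewrite /v /C /qdot /= J0; ring.
have sq J : imag_unit J -> e ^+ 2 <= s + 2 * qdot J v.
  by move=> J1; rewrite -nJ // lerXn2r ?nnegrE ?eAB // ltW.
have w0 := normr_ge0 v; set w := `|v| in n2E w0 *.
have e20 : 0 < e ^+ 2 by rewrite exprn_gt0.
have le_s : e ^+ 2 <= s - 2 * w.
  have [v0|v0] := eqVneq w 0.
    have := sq I I1; have -> : v = 0 by apply/eqP; rewrite -normr_eq0 -/w v0.
    by rewrite v0 linear0 !mulr0 subr0 addr0.
  (* The minimum over the sphere is attained at J = - v / |v|. *)
  have J1 : imag_unit (- w^-1 *: v).
    apply/imag_unitE; split; first by rewrite /= mulr0.
    have : w ^+ 2 = sqnorm v by rewrite -qnorm_sqr.
    rewrite /sqnorm /= expr0n add0r => w2.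
    by rewrite !exprMn -!mulrDr -w2 sqrrN exprVn mulVf // sqrf_eq0.
  have := sq _ J1; rewrite qdotC linearZ /= qdotqq -/w.
  suff -> : (- w^-1) *: (w ^+ 2) = - w by rewrite mulrN.
  by rewrite /GRing.scale /= expr2; field.
(* The first factor is the minimum, at least e^2; the second is at least |A + J B|^2 for every J. *)
have fac : n2 = (s - 2 * w) * (s + 2 * w) by rewrite n2E; ring.
have le1 : e ^+ 2 * (s + 2 * w) <= n2 by rewrite fac ler_wpM2r //; lra.
split; apply: le_trans le1; apply: (ler_wpM2l (ltW e20)); first lra.
rewrite nJ //; have := le_trans (ler_norm _) (le_qdot I v).
by rewrite (qnorm_imag_unit I1) mul1r -/w => ?; lra.
Qed.

End Stem.

(** * Star powers and Laurent expansions *)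

Section StarPowers.
Variable R : realType.
Local Notation H := (quaternion R).
Implicit Types (I J p q : H) (h : R * R -> H) (z w u : R * R).

Lemma quat_Im_slice I z : imag_unit I -> quat_Im (slice_pt I z) = z.2 *: I.
Proof.
move=> /imag_unitE[I0 _]; rewrite /quat_Im slice_ptE.
by apply: quatP; rewrite /= I0; ring.
Qed.

Lemma qre_slice I z : imag_unit I -> qre (slice_pt I z) = z.1.
Proof. by move=> /imag_unitE[I0 _]; rewrite slice_ptE /= I0 mulr0 addr0. Qed.

Lemma norm_quat_Im_slice I z : imag_unit I -> `|quat_Im (slice_pt I z)| = `|z.2|.
Proof. by move=> I1; rewrite quat_Im_slice // normrZ qnorm_imag_unit // mulr1. Qed.

(** The unit of [q] is Im q / |Im q|. At a real [q] this is 0, because 0^-1 = 0, and the value is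
    still right: z equals its conjugate there and the terms in J cancel. *)
Definition slice_ext I h q : H :=
  repr_ext I (`|quat_Im q|^-1 *: quat_Im q) h (qre q, `|quat_Im q|).

(** For y < 0 the unit computed from the point is - J; replacing (J, y) by (- J, - y) only exchanges
    the two terms of the formula. *)
Lemma slice_extE I J h z : imag_unit J ->
  slice_ext I h (slice_pt J z) = repr_ext I J h z.
Proof.
move=> J1; rewrite /slice_ext quat_Im_slice // qre_slice // normrZ.
rewrite (qnorm_imag_unit J1) mulr1 scalerA; case: z => x y /=.
have [y0|y0|->] := ltgtP y 0.
- rewrite (ltr0_norm y0) invrN mulNr mulVf ?lt_eqF // scaleN1r.
  by rewrite /repr_ext /conjp /= opprK mulNr opprK addrC.
- by rewrite (gtr0_norm y0) mulVf ?gt_eqF // scale1r.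
- rewrite normr0 mulr0 scale0r /repr_ext /conjp /= oppr0 mul0r subr0 addr0.
  by rewrite -!mulrDl addrACA addNr addr0.
Qed.

Lemma hol_exp I D h n : open D -> (forall z, D z -> I * h z = h z * I) ->
  hol I D h -> hol I D (fun z => h z ^+ n).
Proof.
move=> Do hI hh; elim: n => [|n IH]; first exact: hol_cst.
by under eq_fun do rewrite exprS; exact: hol_mul.
Qed.

Lemma hol_expz I D h (n : int) : open D -> (forall z, D z -> I * h z = h z * I) ->
  (n < 0 -> forall z, D z -> h z != 0) ->
  hol I D h -> hol I D (fun z => h z ^ n).
Proof.
move=> Do hI h0 hh; case: n h0 => n h0; first exact: hol_exp.
have hn0 z : D z -> h z ^+ n.+1 != 0.
  by move=> Dz; rewrite -normr_eq0 qnormX expf_neq0 // normr_eq0 h0.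
rewrite (_ : (fun z => _) = fun z => (h z ^+ n.+1)^-1) //.
apply: hol_inv => //; last exact: hol_exp.
by move=> z Dz; exact: (commrX _ (hI z Dz)).
Qed.

(** The point of the statement is that [u'] is the same for every [J]. *)
Lemma slice_pt_exp u (n : nat) : exists u', forall J, imag_unit J ->
  slice_pt J u ^+ n = slice_pt J u'.
Proof.
elim: n => [|n [u' IH]].
  by exists (1, 0) => J J1; rewrite slice_pt_real scale1r.
by exists (cmul u u') => J J1; rewrite exprS IH // slice_ptM.
Qed.

Lemma slice_pt_inv u : exists u', forall J, imag_unit J ->
  (slice_pt J u)^-1 = slice_pt J u'.
Proof.
exists ((u.1 ^+ 2 + u.2 ^+ 2)^-1 *: conjp u) => J J1.
have [u0|u0] := eqVneq (slice_pt J u) 0.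
  by rewrite u0 invr0 (slice_pt_eq0 J1 u0) /conjp /= oppr0 scaler0 slice_pt0.
have S0 : u.1 ^+ 2 + u.2 ^+ 2 != 0.
  apply: contra u0 => /eqP S0; rewrite -normr_eq0 qnorm_slice_pt // S0.
  by rewrite sqrtr0.
apply: (can_inj (mulKr (x := slice_pt J u) _)); first by rewrite qunitE.
rewrite mulrV ?qunitE // slice_ptZ -scalerAr slice_ptM //.
have -> : cmul u (conjp u) = (u.1 ^+ 2 + u.2 ^+ 2, 0).
  by congr (_, _) => /=; ring.
by rewrite slice_pt_real scalerA mulVf // scale1r.
Qed.

Lemma slice_pt_expz u (n : int) : exists u', forall J, imag_unit J ->
  slice_pt J u ^ n = slice_pt J u'.
Proof.
case: n => n; first exact: slice_pt_exp.
have [u' u'P] := slice_pt_exp u n.+1; have [u'' u''P] := slice_pt_inv u'.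
by exists u'' => J J1; rewrite -u''P // -u'P.
Qed.

Lemma repr_ext_slice I J u : imag_unit I ->
  repr_ext I J (slice_pt I) u = slice_pt J u.
Proof.
move=> I1; rewrite repr_ext_stem /stem_re /stem_im /conjp /slice_pt /=.
have -> : u.1%:A + u.2 *: I + (u.1%:A + - u.2 *: I) = 2 *: u.1%:A.
  by rewrite addrACA scaleNr addrN addr0 -mulr2n -scaler_nat.
have -> : u.1%:A + - u.2 *: I - (u.1%:A + u.2 *: I) = 2 *: (- u.2 *: I).
  rewrite opprD addrACA addrN add0r -scaleNr -mulr2n.
  by rewrite scaler_nat.
have half (q : H) : 2^-1 *: (2 *: q) = q.
  by rewrite scalerA mulVf ?pnatr_eq0 // scale1r.
rewrite half -[I * _]scalerAr half -[I * _]scalerAr (imag_unit_sqr I1).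
by rewrite scaleNr scalerN opprK -scalerAr mulr1.
Qed.

Lemma same_slice I J z w : imag_unit I -> imag_unit J -> z.2 != 0 ->
  slice_pt I z = slice_pt J w -> J = I \/ J = - I.
Proof.
move=> I1 J1 z2 /(congr1 (@quat_Im R)); rewrite !quat_Im_slice // => e.
have : `|z.2| = `|w.2|.
  have := congr1 (fun q => `|q|) e.
  by rewrite /= !normrZ !qnorm_imag_unit // !mulr1.
have w2 : w.2 != 0.
  apply: contra_neq z2 => w0; move: e; rewrite w0 scale0r => /eqP.
  rewrite scaler_eq0 => /orP[/eqP //|/eqP I0].
  by move/eqP: (qnorm_imag_unit I1); rewrite I0 normr0 eq_sym oner_eq0.
move=> /eqP; rewrite eqr_norm2 => /orP[] /eqP zw; move: e; rewrite zw.
  by move=> /(scalerI w2) ->; left.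
by rewrite scaleNr -scalerN => /(scalerI w2) <-; right.
Qed.

Lemma same_sphereP I J z w : imag_unit I -> imag_unit J ->
  same_sphere (slice_pt I z) (slice_pt J w) <-> w = z \/ w = conjp z.
Proof.
move=> I1 J1; split=> [[x [y [[I' I'1 zE] [J' J'1 wE]]]]|wz]; last first.
  case: z wz => x y wz; exists x, y; split; first by exists I.
  case: wz => ->; first by exists J.
  exists (- J); first exact: imag_unitN.
  by rewrite slice_ptN.
have := congr1 (@qre R) zE; have := congr1 (@qre R) wE.
rewrite !qre_slice //= => wx zx.
have := congr1 (fun q => `|quat_Im q|) zE.
have := congr1 (fun q => `|quat_Im q|) wE.
rewrite !norm_quat_Im_slice //= => -> /eqP; rewrite eqr_norm2 /conjp.
case: z w wx zx {zE wE} => z1 z2 [w1 w2] /= <- <- /orP[/eqP->|/eqP->].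
  by left.
by right.
Qed.

Lemma open_star_power_dom I J z n : imag_unit I -> imag_unit J ->
  open (slice (star_power_dom (slice_pt I z) n) J).
Proof.
move=> I1 J1; rewrite /slice /star_power_dom; case: ifP => _; first exact: openT.
rewrite (_ : _ @^-1` _ = ~` [set z] `&` ~` [set conjp z]).
  have cl (v : R * R) : closed [set v].
    by apply: accessible_closed_set1; apply: hausdorff_accessible; exact: norm_hausdorff.
  by apply: openI; apply: closed_openC.
apply/seteqP; split=> w /=.
  move=> nw; split=> wz; apply: nw; apply/same_sphereP => //; [by left|by right].
by move=> [n1 n2] /(@same_sphereP I J z w I1 J1)[]; [exact: n1|exact: n2].
Qed.

Lemma conjpK : cancel (@conjp R) (@conjp R).
Proof. by case=> x y; rewrite /conjp /= opprK. Qed.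

Lemma repr_extN I J h z : repr_ext I (- J) h z = repr_ext I J h (conjp z).
Proof. by rewrite /repr_ext conjpK mulNr opprK addrC. Qed.

Definition star_power I z (n : int) : H -> H :=
  slice_ext I (fun w => (slice_pt I w - slice_pt I z) ^ n).

Lemma star_power_slice I z n w : imag_unit I ->
  star_power I z n (slice_pt I w) = (slice_pt I w - slice_pt I z) ^ n.
Proof. by move=> I1; rewrite /star_power slice_extE // repr_ext_id. Qed.

(** Regularity is [hol_repr_ext] on each line. The prescribed values must hold on every line through
    p: the line of I alone if p is not real, all lines if p is real. *)
Lemma is_star_power_star_power I z n : imag_unit I ->
  is_star_power (slice_pt I z) n (star_power I z n).
Proof.
move=> I1; split.
  apply: hol_regular => J J1; first exact: open_star_power_dom.
  have dom w : slice (star_power_dom (slice_pt I z) n) J w <->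
      slice (star_power_dom (slice_pt I z) n) I w.
    rewrite /slice /star_power_dom /=; case: ifP => // _ /=.
    by split; apply: contra_not => /same_sphereP h; apply/same_sphereP => //; apply: h.
  rewrite (_ : _ \o _ = repr_ext I J (fun w => (slice_pt I w - slice_pt I z) ^ n)).
    apply: hol_repr_ext => // [w|].
      rewrite /slice /star_power_dom /=; case: ifP => // _ /=.
      apply: contra_not => /same_sphereP h; apply/same_sphereP => //.
      by case: (h I1 J1) => e; [right|left]; apply: (can_inj conjpK); rewrite e ?conjpK.
    apply: hol_expz; first exact: open_star_power_dom.
    - by move=> w _; rewrite -slice_ptB slice_pt_comm.
    - move=> n0 w /dom; rewrite /slice /star_power_dom /= leNgt n0 /=.
      move=> nw; apply/eqP => /subr0_eq /(slice_pt_inj I1) wz.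
      by apply: nw; apply/same_sphereP => //; left.
    - exact: hol_slice_pt.
  by apply/funext => w; rewrite /= /star_power slice_extE.
move=> J J1 [w _ zE] _ [v _ <-] _; rewrite /star_power slice_extE //.
have [z0|z0] := eqVneq z.2 0; last first.
  have [->|->] := same_slice I1 J1 z0 (esym zE); first by rewrite repr_ext_id.
  by rewrite repr_extN repr_ext_id // slice_ptN.
(* For real p, the power has the same coordinates [u'] on every line, and the extension of such a
   function is itself. *)
have [u' u'P] := slice_pt_expz (v - z) n.
have zz J' : slice_pt J' z = (z.1)%:A by rewrite /slice_pt z0 scale0r addr0.
have pow J' : imag_unit J' -> (slice_pt J' v - slice_pt I z) ^ n = slice_pt J' u'.
  by move=> J'1; rewrite (zz I) -(zz J') -slice_ptB u'P.
rewrite (pow J J1) -(repr_ext_slice J u' I1) /repr_ext (pow I I1).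
have := pow _ (imag_unitN I1); rewrite !slice_ptN => ->.
by [].
Qed.

End StarPowers.

Section BilateralSums.
Variable R : realType.
Local Notation H := (quaternion R).

(** Applies the representation formula to a Laurent series termwise; the factors [a] and [b] stand
    on the left, the coefficients on the right. *)
Lemma bilateral_comb (u v : int -> H) (s t a b : H) (k : R) :
  has_bilateral_sum u s -> has_bilateral_sum v t ->
  has_bilateral_sum (fun n => k *: (a * u n + b * v n)) (k *: (a * s + b * t)).
Proof.
move=> [s1 [s2 [u1 u2 ->]]] [t1 [t2 [v1 v2 ->]]].
have comb (x y : nat -> H) p q : series x @ \oo --> p -> series y @ \oo --> q ->
    series (fun n => k *: (a * x n + b * y n)) @ \oo --> k *: (a * p + b * q).
  move=> xp yq.
  rewrite (_ : series _ = fun N => k *: (a * series x N + b * series y N)).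
    apply: cvgZl_tmp; apply: cvgD.
      by apply: qmul_cvg => //; exact: cvg_cst.
    by apply: qmul_cvg => //; exact: cvg_cst.
  apply/funext => N; rewrite /series /= -scaler_sumr big_split /=.
  by rewrite !mulr_sumr.
exists (k *: (a * s1 + b * t1)), (k *: (a * s2 + b * t2)); split; try exact: comb.
by rewrite -scalerDr addrACA -!mulrDr.
Qed.

(** The coefficients of u^(-m) times the power series with coefficients [b]. *)
Definition laurent_coef (m : nat) (b : nat -> H) (n : int) : H :=
  if 0 <= n + m%:Z then b (absz (n + m%:Z)) else 0.

Lemma laurent_coef_eq0 m b (k : nat) : (m < k)%N -> laurent_coef m b (- k%:Z) = 0.
Proof. by move=> mk; rewrite /laurent_coef ifF //; apply/negP => h; lia. Qed.

Lemma laurent_sum (m : nat) (b : nat -> H) (u s : H) : u != 0 ->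
  series (fun n => u ^+ n * b n) @ \oo --> u ^+ m * s ->
  has_bilateral_sum (fun n => u ^ n * laurent_coef m b n) s.
Proof.
move=> u0 bS.
have um0 : u ^+ m != 0 by rewrite -normr_eq0 qnormX expf_neq0 // normr_eq0.
have uu : u \is a GRing.unit by rewrite qunitE.
pose P := \sum_(k < m) u ^+ k * b k.
have key (k j : nat) : u ^ (- k.+1%:Z) = (u ^+ (j + k.+1))^-1 * u ^+ j.
  rewrite exprD invrM ?unitrX // -mulrA qmulVr ?mulr1 //.
  by rewrite -normr_eq0 qnormX expf_neq0 // normr_eq0.
exists (s - (u ^+ m)^-1 * P), ((u ^+ m)^-1 * P); split; last by rewrite subrK.
- rewrite (_ : series _ = fun N => (u ^+ m)^-1 *
      (series (fun n => u ^+ n * b n) (N + m)%N - P)).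
    have -> : s - (u ^+ m)^-1 * P = (u ^+ m)^-1 * (u ^+ m * s - P).
      by rewrite mulrBr mulrA qmulVr // mul1r.
    apply: qmul_cvg; first exact: cvg_cst.
    apply: cvgB; last exact: cvg_cst.
    by rewrite (cvg_shiftn m (series (fun n => u ^+ n * b n))).
  apply/funext => N; rewrite /series /= !big_mkord addnC big_split_ord /=.
  rewrite addrAC subrr add0r mulr_sumr; apply: eq_bigr => i _.
  rewrite /laurent_coef -PoszD /= exprD !mulrA qmulVr // mul1r addnC.
  by [].
- rewrite -(cvg_shiftn m).
  rewrite (_ : (fun n => _) = fun=> (u ^+ m)^-1 * P); first exact: cvg_cst.
  apply/funext => N; rewrite /series /= big_mkord addnC big_split_ord /=.
  rewrite [X in _ + X]big1 ?addr0; last first.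
    move=> i _; rewrite /laurent_coef ifF ?mulr0 //.
    by apply/negP => /=; lia.
  (* Reversal pairs the exponent -(k + 1) with [b i] for i = m - 1 - k. *)
  rewrite mulr_sumr /P (reindex_inj rev_ord_inj) /=; apply: eq_bigr => i _.
  have im := ltn_ord i.
  rewrite mulrA; congr (_ * _).
    rewrite (key _ i); congr (_ ^- _ * _); lia.
  by rewrite /laurent_coef ifT; [congr b|]; lia.
Qed.

End BilateralSums.

(** * Essential singularities *)

Section PoleBound.
Variable R : realType.
Local Notation H := (quaternion R).
Implicit Types (I J p q : H) (F : R * R -> H) (z w : R * R).

Lemma pole_bound I F (D : set (R * R)) z0 (rho e : R) : imag_unit I ->
  open D -> (forall z, D z -> D (conjp z)) -> hol I D F -> 0 < rho -> 0 < e ->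
  (forall w, punctured I rho w -> D (w + z0)) ->
  (forall w J, punctured I rho w -> imag_unit J -> e <= `|repr_ext I J F (w + z0)|) ->
  exists (m : nat) (C r : R), [/\ 0 < r, r <= rho, 0 <= C &
    forall w, punctured I r w -> `|slice_pt I w| ^+ m * `|F (w + z0)| <= C].
Proof.
move=> I1 Do Dc hF rho0 e0 wD we.
have e20 : 0 < e ^+ 2 by rewrite exprn_gt0.
pose N w := stem_norm I F (w + z0).
have minmax w : punctured I rho w ->
    e ^+ 2 <= `|N w| /\ e * `|F (w + z0)| <= `|N w|.
  move=> wP.
  have eJ J : imag_unit J ->
      e <= `|stem_re F (w + z0) + J * stem_im I F (w + z0)|.
    by move=> J1; rewrite -repr_ext_stem; exact: we.
  have [] := sphere_min_max e0 I1 eJ.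
  rewrite -repr_ext_stem repr_ext_id // -!exprMn.
  have -> : (`|stem_re F (w + z0)| ^+ 2 - `|stem_im I F (w + z0)| ^+ 2) ^+ 2 +
     (2 * qdot (stem_re F (w + z0)) (stem_im I F (w + z0))) ^+ 2 = `|N w| ^+ 2.
    by rewrite /N /stem_norm qnorm_slice_pt // [RHS]sqr_sqrtr /= ?addr_ge0 ?sqr_ge0.
  by rewrite !ler_pXn2r ?nnegrE ?mulr_ge0 ?(ltW e0) ?(ltW e20) // -expr2.
have Nn0 w : punctured I rho w -> N w != 0.
  move=> /minmax[le1 _]; rewrite -normr_gt0; exact: lt_le_trans le1.
have hN : hol I (punctured I rho) N.
  by apply: hol_sub (hol_shift z0 (hol_stem_norm I1 Do Dc hF)).
have op : open (punctured I rho) by exact: open_punctured.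
have hW : hol I (punctured I rho) (fun w => (N w)^-1).
  by apply: hol_inv => // w _; exact: slice_pt_comm.
have WB w : punctured I rho w -> `|(N w)^-1| <= (e ^+ 2)^-1.
  move=> wP; have [le1 _] := minmax w wP.
  by rewrite qnormV lef_pV2 ?posrE // (lt_le_trans e20).
pose r := rho / 2.
have r0 : 0 < r by rewrite divr_gt0.
have rr : r < rho by rewrite /r; lra.
have [a [M M0 [aM aS]]] := removable I1 r0 rr hW WB.
(* Otherwise 1/N would vanish near the center, although N is finite and nonzero there. *)
have ex : exists n, a n != 0.
  apply: contrapT => /forallNP a0.
  pose w : R * R := (r / 2, 0).
  have cw : `|slice_pt I w| = r / 2.
    by rewrite slice_pt_real normrZ qnorm1 mulr1 gtr0_norm ?divr_gt0.
  have wP : punctured I r w by rewrite /punctured /= cw; apply/andP; split; lra.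
  have wP' : punctured I rho w by rewrite /punctured /= cw; apply/andP; split; lra.
  have := aS w wP; rewrite (_ : series _ = fun=> 0); last first.
    apply/funext => n; rewrite /series /= big1 // => i _.
    by have /negP := a0 i; rewrite negbK => /eqP ->; rewrite mulr0.
  move=> h; have : (N w)^-1 = 0 by apply: (qcvg_unique h); exact: cvg_cst.
  move=> /(congr1 (fun q => `|q|)) /eqP; rewrite qnormV normr0 invr_eq0 normr_eq0.
  by apply/negP; exact: Nn0.
pose m := ex_minn ex.
have [am0 amin] : a m != 0 /\ forall n, (n < m)%N -> a n = 0.
  rewrite /m; case: ex_minnP => k ak kmin; split=> // n nk.
  by apply/eqP; apply: contraTT nk => /kmin; rewrite -leqNgt.
have ap : 0 < `|a m| by rewrite normr_gt0.
(* The tail of 1/N beyond its leading term is at most u^m (K u), with u = |w|; below [r1] this is at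
   most half the leading term u^m |a m|. *)
pose K := 2 * M / r ^+ m.+1.
have K0 : 0 <= K by rewrite divr_ge0 ?mulr_ge0 ?exprn_ge0 // ltW.
pose r1 := Num.min (r / 2) (`|a m| / (2 * (K + 1))).
have K1 : 0 < K + 1 by rewrite ltr_wpDl.
have r10 : 0 < r1 by rewrite lt_min !divr_gt0 // mulr_gt0.
have r1r : r1 <= r / 2 by rewrite ge_min lexx.
have r1K : r1 <= `|a m| / (2 * (K + 1)) by rewrite ge_min lexx orbT.
(* From |1/N| >= u^m |a m| / 2 follows u^m |N| <= 2 / |a m|; then e |F| <= |N| gives the
   constant. *)
exists m, (2 / (e * `|a m|)), r1; split => //.
- by apply: le_trans r1r _; lra.
- by rewrite divr_ge0 // mulr_ge0 // ltW.
move=> w /andP[w0 wr1].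
have wP : punctured I r w by rewrite /punctured /= w0 /=; lra.
have wP' : punctured I rho w by rewrite /punctured /= w0 /=; lra.
have [_ le2] := minmax w wP'.
have wr2 : `|slice_pt I w| <= r / 2 by lra.
have lead := lead_bound r0 M0 aM amin wr2 (aS w wP).
set u := `|slice_pt I w| in w0 wr1 wr2 lead *.
have um : 0 < u ^+ m by rewrite exprn_gt0.
have low : u ^+ m * (`|a m| / 2) <= `|(N w)^-1|.
  have tri : u ^+ m * `|a m| - 2 * M * (u / r) ^+ m.+1 <= `|(N w)^-1|.
    have -> : u ^+ m * `|a m| = `|slice_pt I w ^+ m * a m| by rewrite qnormM qnormX.
    have := lerB_dist (slice_pt I w ^+ m * a m) (N w)^-1.
    by rewrite distrC => ?; lra.
  apply: le_trans tri.
  have -> : 2 * M * (u / r) ^+ m.+1 = u ^+ m * (K * u).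
    by rewrite /K expr_div_n exprS; ring.
  rewrite -mulrBr ler_pM2l //.
  have : (K + 1) * u <= `|a m| / 2.
    have -> : `|a m| / 2 = (K + 1) * (`|a m| / (2 * (K + 1))).
      by field; rewrite gt_eqF.
    by rewrite ler_pM2l //; lra.
  by have := ltW w0; nra.
have Np : 0 < `|N w| by rewrite normr_gt0 Nn0.
rewrite qnormV in low.
have {}low : u ^+ m * `|N w| <= 2 / `|a m|.
  rewrite -(ler_pM2r Np) mulVf ?gt_eqF // in low.
  by rewrite ler_pdivlMr //; lra.
apply: (@le_trans _ _ (u ^+ m * (`|N w| / e))).
  by rewrite ler_pM2l // ler_pdivlMr // mulrC.
rewrite mulrA ler_pdivrMr //; apply: le_trans low _.
by rewrite le_eqVlt; apply/orP; left; apply/eqP; field; rewrite ?gt_eqF.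
Qed.

End PoleBound.

Section EssentialSingularity.
Variable R : realType.
Local Notation H := (quaternion R).
Implicit Types (I J p q : H) (Omega U : set H) (f : H -> H) (z w : R * R).

Lemma Sigma_slice I z0 (r : R) w : imag_unit I ->
  Sigma (slice_pt I z0) 0 r (slice_pt I (w + z0)) <-> punctured I r w.
Proof.
move=> I1; have sl : same_line (slice_pt I z0) (slice_pt I (w + z0)).
  by exists I; split=> //; [exists z0|exists (w + z0)].
rewrite /Sigma /punctured /= /tau_dist /sigma_dist asboolT //.
rewrite -slice_ptB addrK; split; first by move=> [-> ->].
by move=> /andP[].
Qed.

Lemma Sigma_sub p (r r' : R) : r <= r' -> Sigma p 0 r `<=` Sigma p 0 r'.
Proof. by move=> rr q [q0 qr]; split=> //; exact: lt_le_trans rr. Qed.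

(* A radius at most |Im p| confines the set to the complex line through a
   nonreal p. *)
Lemma Sigma_cases I z0 (r : R) q : imag_unit I ->
  (z0.2 != 0 -> r <= `|z0.2|) -> Sigma (slice_pt I z0) 0 r q ->
  (exists w, q = slice_pt I w) \/
  z0.2 = 0 /\ exists J w, imag_unit J /\ q = slice_pt J w.
Proof.
move=> I1 rz [_]; rewrite /sigma_dist; case: asboolP => [[J [J1 [z _ zE] [w _ wE]]] _|nl].
  have [z2|z2] := eqVneq z0.2 0; first by right; split=> //; exists J, w.
  left; have [JI|JI] := same_slice I1 J1 z2 (esym zE).
    by exists w; rewrite -JI.
  by exists (conjp w); rewrite -wE JI slice_ptN.
have [z2|z2] := eqVneq z0.2 0.
  have [J [x [y [J1 _ qE]]]] := on_slice q.
  by right; split=> //; exists J, (x, y).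
(* Off the lines through a nonreal p, sigma is at least |Im p| >= r. *)
rewrite norm_quat_Im_slice // => lt1; exfalso.
move: (rz z2); apply/negP; rewrite -ltNge; apply: le_lt_trans lt1.
rewrite -[leLHS]ger0_norm // -sqrtr_sqr ler_sqrt ?addr_ge0 ?sqr_ge0 //.
have := sqr_ge0 (qre q - qre (slice_pt I z0)).
have := normr_ge0 (quat_Im q); have := normr_ge0 z0.2.
set a := `|z0.2|; set b := `|quat_Im q|; set d := _ ^+ 2 => a0 b0 d0.
by rewrite sqrrD; nra.
Qed.

Lemma regular_subc f Omega v : slice_domain Omega -> regular_on Omega f ->
  regular_on Omega (fun q => f q - v).
Proof.
move=> [_ _ _ sl] rf; apply: hol_regular => I I1; first by have [] := sl I I1.
have := hol_add (regular_hol rf I1) (hol_cst I (slice Omega I) (- v)).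
by [].
Qed.

End EssentialSingularity.

Theorem theorem8p2 (R : realType) (Omega : set (quaternion R))
    (f : quaternion R -> quaternion R) (p : quaternion R)
    (U : set (quaternion R)) :
  slice_domain Omega -> symmetric_set Omega -> regular_on Omega f ->
  is_essential_singularity Omega f p ->
  nbhs p U -> symmetric_set U ->
  dense (f @` (Omega `&` U)).
Proof.
move=> sdO sO rf [[R0 R00 SO] npole] pU sU O O0 Oo.
apply: contrapT => /nonemptyPn disj; apply: npole.
have [v Ov] := O0.
have [e e0 ev] : exists2 e : R, 0 < e & forall q, `|q - v| < e -> O q.
  have /nbhs_ballP[e /= e0 eO] : nbhs v O by exact: open_nbhs_nbhs.
  by exists e => // q qe; apply: eO; rewrite -ball_normE /ball_ /= distrC.
have fe q : Omega q -> U q -> e <= `|f q - v|.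
  move=> Oq Uq; rewrite leNgt; apply/negP => /ev Ofq.
  have : (O `&` f @` (Omega `&` U)) (f q) by split=> //; exists q.
  by rewrite disj.
have [I [x0 [y0 [I1 y00 pE]]]] := on_slice p.
pose z0 : R * R := (x0, y0).
have [d d0 dU] : exists2 d : R, 0 < d & forall q, `|q - p| < d -> U q.
  have /nbhs_ballP[d /= d0 dU] := pU.
  by exists d => // q qd; apply: dU; rewrite -ball_normE /ball_ /= distrC.
pose rho := Num.min R0 d.
have rho0 : 0 < rho by rewrite lt_min R00.
have [Do Dc] : open (slice Omega I) /\ connected (slice Omega I).
  by have [_ _ _] := sdO; apply.
have inO w : punctured I rho w -> slice Omega I (w + z0).
  move=> /andP[w0]; rewrite lt_min => /andP[wR _].
  by apply: SO; rewrite pE; apply/(Sigma_slice _ _ _ I1); rewrite /punctured /= w0.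
have inU w : punctured I rho w -> slice U I (w + z0).
  move=> /andP[w0]; rewrite lt_min => /andP[_ wd].
  by apply: dU; rewrite pE -slice_ptB addrK.
have rf1 := regular_subc v sdO rf.
(* By symmetry of [Omega] and [U], a point of the punctured disc brings its whole sphere into both
   sets, so the lower bound e holds for all units J. *)
have [w J wP J1|m [C [r1 [r10 r1rho C0 fC]]]] := @pole_bound R I ((fun q => f q - v) \o slice_pt I)
    (slice Omega I) z0 rho e I1 Do (fun z => slice_conjp sO I1) (regular_hol rf1 I1)
    rho0 e0 inO.
  rewrite -(representation sdO sO rf1 I1 J1 (inO w wP)).
  by apply: fe; [exact: (slice_symmetric sO I1 J1 (inO w wP))|
                 exact: (slice_symmetric sU I1 J1 (inU w wP))].
pose F := f \o slice_pt I.
have hF : hol I (slice Omega I) F by exact: regular_hol.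
pose G w := slice_pt I w ^+ m * F (w + z0).
have sub1 : punctured I r1 `<=` punctured I rho.
  by move=> w /andP[w0 wr]; rewrite /punctured /= w0; exact: lt_le_trans r1rho.
have hG : hol I (punctured I r1) G.
  have op : open (punctured I r1) by exact: open_punctured.
  apply: hol_mul => //.
  - by move=> w _; exact: (commrX _ (slice_pt_comm w I1)).
  - apply: hol_exp => //; first by move=> w _; exact: slice_pt_comm.
    have := @hol_slice_pt R I (punctured I r1) 0.
    by under eq_fun do rewrite subr0.
  - by apply: hol_sub (hol_shift z0 hF) => w /sub1 /inO.
(* [C] bounds |w|^m |f - v|; restoring the constant v costs at most r1^m |v|. *)
have GB w : punctured I r1 w -> `|G w| <= C + r1 ^+ m * `|v|.
  move=> wP; have /andP[w0 wr1] := wP.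
  rewrite /G qnormM qnormX -[F _](subrK v).
  apply: (@le_trans _ _ (`|slice_pt I w| ^+ m * (`|F (w + z0) - v| + `|v|))).
    by rewrite ler_wpM2l ?exprn_ge0 // ler_normD.
  rewrite mulrDr lerD ?fC // ler_wpM2r //.
  by rewrite lerXn2r ?nnegrE // ?ltW.
pose r2 := r1 / 2.
have r20 : 0 < r2 by rewrite divr_gt0.
have r2r : r2 < r1 by rewrite /r2; lra.
have [b [M _ [_ bS]]] := removable I1 r20 r2r hG GB.
(* For nonreal p the radius is kept below |Im p| = y0, as [Sigma_cases] requires. *)
pose r := if y0 == 0 then r2 else Num.min r2 y0.
have r0 : 0 < r.
  by rewrite /r; case: eqVneq => // yn; rewrite lt_min r20 lt_neqAle eq_sym yn.
have rr2 : r <= r2 by rewrite /r; case: ifP => // _; rewrite ge_min lexx.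
have ry : z0.2 != 0 -> r <= `|z0.2|.
  by rewrite /r /= => /negPf ->; rewrite ger0_norm // ge_min lexx orbT.
have rR : r <= R0.
  apply: (le_trans rr2); apply: (le_trans (ltW r2r)); apply: (le_trans r1rho).
  by rewrite ge_min lexx.
exists r, (laurent_coef m b); split => //.
- exact: subset_trans (Sigma_sub rR) SO.
- exists (star_power I z0); split.
    by move=> n; rewrite pE; exact: is_star_power_star_power.
  have slice_sum w : punctured I r (w - z0) ->
      has_bilateral_sum (fun n => (slice_pt I w - slice_pt I z0) ^ n *
         laurent_coef m b n) (F w).
    move=> /andP[w0 wr]; rewrite -slice_ptB; apply: laurent_sum.
      by rewrite -normr_gt0.
    have := bS (w - z0); rewrite /G subrK; apply.
    by rewrite /punctured /= w0; exact: lt_le_trans rr2.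
  move=> q; rewrite pE => Sq.
  have [[w qE]|[z02 [J [w [J1 qE]]]]] := Sigma_cases I1 ry Sq.
    rewrite qE; under eq_fun do rewrite star_power_slice //.
    by apply: slice_sum; apply/(Sigma_slice z0 r _ I1); rewrite subrK -qE.
  (* Here p is real: its coordinates are the same on all lines, and the punctured disc about it is
     stable under conjugation, so the expansion holds at w and at its conjugate. *)
  have pJ K : slice_pt K z0 = slice_pt I z0 by rewrite /slice_pt z02 !scale0r.
  have wP : punctured I r (w - z0).
    have : Sigma (slice_pt J z0) 0 r (slice_pt J ((w - z0) + z0)).
      by rewrite pJ subrK -qE.
    move=> /(Sigma_slice _ _ _ J1); rewrite /punctured /=.
    by rewrite !qnorm_slice_pt.
  have wcP : punctured I r (conjp w - z0).
    have -> : conjp w - z0 = conjp (w - z0).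
      by rewrite /conjp; congr (_, _); rewrite /= opprB; move: z02 => /= ->; rewrite subr0 sub0r.
    by move: wP; rewrite /punctured /= !qnorm_slice_pt //= sqrrN.
  have wO : slice Omega I w.
    rewrite -(subrK z0 w); apply: inO; apply: sub1.
    have /andP[w0 wr] := wP; rewrite /punctured /= w0 /=.
    exact: (lt_trans (lt_le_trans wr rr2)).
  rewrite qE (representation sdO sO rf I1 J1 wO).
  (* The representation formula for f is, term by term, that of the star powers, because the
     coefficients stand on the right. *)
  have := bilateral_comb (1 - J * I) (1 + J * I) 2^-1 (slice_sum _ wP) (slice_sum _ wcP).
  rewrite (_ : (fun n => _) = fun n => star_power I z0 n (slice_pt J w) * laurent_coef m b n) //.
  apply/funext => n; rewrite /star_power slice_extE // /repr_ext.
  by rewrite -scalerAl; congr (_ *: _); rewrite [RHS]mulrDl -!mulrA.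
- by exists m => k; exact: laurent_coef_eq0.
Qed.
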